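(* Let $\mathcal{S}_{n,L,\lambda,\sigma,\tau,z}$ be the colored stochastic symplectic ice with $\sigma,\tau\in B_n$, $\lambda=(\lambda_1\ge\dots\ge\lambda_n\ge0)$ a partition and $L\ge\lambda_1+n$. Make the change of variables $u_i=\frac{1-qz_i}{1-z_i}$ (equivalently $z_i=\frac{1-u_i}{q-u_i}$), $1\le i\le n$, and regard $$Z(\tilde{\mathcal{S}}_{n,L,\lambda,\sigma,\tau,u})=Z(\mathcal{S}_{n,L,\lambda,\sigma,\tau,z})\,\frac{q^{\sum_{i=1}^n(n-i)1_{\sigma(i)>0}+(L+1)\sum_{i=1}^n1_{\sigma(i)<0}}}{\prod_{i=1}^nz_i^L}$$ as a function of $u=(u_1,\dots,u_n)$. Then, for $1\le i\le n-1$, if $\sigma(i+1)>\sigma(i)$, $$Z(\tilde{\mathcal{S}}_{n,L,\lambda,\sigma s_i,\tau,u})=\hat{\mathcal{L}}_{i,q}\bigl(Z(\tilde{\mathcal{S}}_{n,L,\lambda,\sigma,\tau,u})\bigr).$$ Moreover, if $\sigma(n)>0$, $$Z(\tilde{\mathcal{S}}_{n,L,\lambda,\sigma s_n,\tau,u})=-\mathcal{L}_{n,q}\bigl(Z(\tilde{\mathcal{S}}_{n,L,\lambda,\sigma,\tau,u})\bigr).$$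
   Context: Parameters: $q,z_1,\dots,z_n$ are indeterminates (equivalently, generic complex numbers for which every denominator is nonzero); $z_i'=q+1-\frac1{z_i}$. $1_E$ is the indicator of the condition $E$. Demazure–Lusztig operators of type C. On vectors $u$: for $1\le i\le n-1$, $s_i(u_1,\dots,u_n)$ interchanges $u_i$ and $u_{i+1}$, and $s_n(u_1,\dots,u_n)=(u_1,\dots,u_{n-1},u_n^{-1})$. For a rational function $f(u)$ let $(s_if)(u)=f(s_iu)$. Put $u^{\alpha_i}=u_i/u_{i+1}$ for $1\le i\le n-1$ and $u^{\alpha_n}=u_n^2$. For a parameter $v$, $$\mathcal{L}_{i,v}(f)=\frac{1-v}{u^{\alpha_i}-1}f+\frac{vu^{\alpha_i}-1}{u^{\alpha_i}-1}s_i(f),\qquad \hat{\mathcal{L}}_{i,v}=\mathcal{L}_{i,v}-v+1\qquad(1\le i\le n).$$ Colors and group. Labels are $[\pm n]\cup\{0\}$, with $[\pm n]=\{\bar n,\dots,\bar1,1,\dots,n\}$, $\overline{\bar k}=k$ ($\bar k$ is also thought of as $-k$), ordered by $\bar n<\dots<\bar1<0<1<\dots<n$. The colors are $c_\alpha$, $\alpha\in[\pm n]$, and $c_0:=+$. $B_n$ is the hyperoctahedral group of permutations $\sigma$ of $[\pm n]$ with $\sigma(\bar k)=\overline{\sigma(k)}$; products are composed right to left, $(\sigma\tau)(k)=\sigma(\tau(k))$. In $B_n$, $s_i$ ($1\le i\le n-1$) is the transposition exchanging $i$ and $i+1$ (and $\bar i$ and $\overline{i+1}$), and $s_n$ fixes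 $1,\dots,n-1$ and sends $n$ to $\bar n$. Vertex weights, as functions of the colors (left, top, right, bottom); unlisted configurations have weight $0$. For every color $x$, $(x,x,x,x)\mapsto1$, and for all labels $\alpha<\beta$: - colored stochastic $\Gamma$ vertex with spectral parameter $z_i$: $(c_\alpha,c_\beta,c_\alpha,c_\beta)\mapsto z_i$, $(c_\beta,c_\alpha,c_\beta,c_\alpha)\mapsto qz_i$, $(c_\beta,c_\alpha,c_\alpha,c_\beta)\mapsto1-qz_i$, $(c_\alpha,c_\beta,c_\beta,c_\alpha)\mapsto1-z_i$. - colored stochastic $\Delta$ vertex with spectral parameter $z_i$: $(c_\alpha,c_\beta,c_\alpha,c_\beta)\mapsto z_i'$, $(c_\beta,c_\alpha,c_\beta,c_\alpha)\mapsto\frac1qz_i'$, $(c_\beta,c_\beta,c_\alpha,c_\alpha)\mapsto1-z_i'$, $(c_\alpha,c_\alpha,c_\beta,c_\beta)\mapsto1-\frac1qz_i'$. Model $\mathcal{S}_{n,L,\lambda,\sigma,\tau,z}$. A rectangular lattice with $2n$ rows numbered $1,\dots,2n$ from bottom to top and $L$ columns numbered $1,\dots,L$ from right to left; for $1\le i\le n$ row $2i-1$ consists of colored stochastic $\Delta$ vertices and row $2i$ of colored stochastic $\Gamma$ vertices, all with spectral parameter $z_i$. Boundary conditions: the left edge of row $2i$ carries $c_{\sigma(i)}$ and the left edge of row $2i-1$ carries $+$; all top edges carry $+$; the bottom edge in column $\lambda_i+n+1-i$ carries $c_{\tau(i)}$ for $1\le i\le n$, and other bottom edges carry $+$. On the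 right, rows $2i$ and $2i-1$ are joined by a cap with weight $K(x,y)$, $x$ and $y$ being the right-most colors of rows $2i$ and $2i-1$: $K(+,+)=1$, $K(c_\alpha,c_{\bar\alpha})=1$ for all $\alpha\in[\pm n]$, and $K=0$ otherwise. The partition function $Z$ is the sum, over all assignments of colors to the edges compatible with the boundary conditions, of the product of all vertex and cap weights. *)

(* Defs.v *)
From mathcomp Require Import all_boot all_order all_algebra all_fingroup.
From mathcomp Require Import ring.

Set Implicit Arguments.
Unset Strict Implicit.
Unset Printing Implicit Defensive.

Import Order.TTheory GRing.Theory Num.Theory.
Local Open Scope ring_scope.

(* Indices 1, ..., n are represented by 'I_n with a shift: i : 'I_n stands for
   i + 1.  The letter (false, i) of [+-n] is i + 1 and (true, i) is its
   opposite. *)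
Definition letter (n : nat) : finType := (bool * 'I_n)%type.

Definition pos_letter (n : nat) (i : 'I_n) : letter n := (false, i).

Definition bar (n : nat) (a : letter n) : letter n := (~~ a.1, a.2).

Definition letter_val (n : nat) (a : letter n) : int :=
  if a.1 then - (a.2.+1)%:Z else (a.2.+1)%:Z.

(* Some a is the color c_a, and None is the color c_0 = +. *)
Definition color (n : nat) : finType := option (letter n).

Definition color_val (n : nat) (x : color n) : int :=
  if x is Some a then letter_val a else 0.

Definition clt (n : nat) (x y : color n) : bool := color_val x < color_val y.

Definition hyperoct (n : nat) : {set {perm letter n}} :=
  [set s : {perm letter n} | [forall a, s (bar a) == bar (s a)]].

(* The product of B_n, composed right to left; the product of {perm _} in the
   library is composed left to right. *)
Definition compB (n : nat) (s t : {perm letter n}) : {perm letter n} :=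
  (t * s)%g.

(* ordS i is i + 1 when i + 1 < n, the only case in which it is used. *)
Definition srefl (n : nat) (i : 'I_n) : {perm letter n} :=
  if (i.+1 < n)%N then
    (tperm (false, i) (false, ordS i) * tperm (true, i) (true, ordS i))%g
  else tperm (false, i) (true, i).

Section Operators.

Variables (F : fieldType) (n : nat).

Definition sact (i : 'I_n) (u : {ffun 'I_n -> F}) : {ffun 'I_n -> F} :=
  if (i.+1 < n)%N then [ffun j => u (tperm i (ordS i) j)]
  else [ffun j => if j == i then (u j)^-1 else u j].

Definition ualpha (i : 'I_n) (u : {ffun 'I_n -> F}) : F :=
  if (i.+1 < n)%N then u i / u (ordS i) else u i ^+ 2.

Definition DL (i : 'I_n) (v : F) (f : {ffun 'I_n -> F} -> F) :
    {ffun 'I_n -> F} -> F :=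
  fun u => (1 - v) / (ualpha i u - 1) * f u
           + (v * ualpha i u - 1) / (ualpha i u - 1) * f (sact i u).

Definition DLhat (i : 'I_n) (v : F) (f : {ffun 'I_n -> F} -> F) :
    {ffun 'I_n -> F} -> F :=
  fun u => DL i v f u - v * f u + f u.

End Operators.

Section Weights.

Variables (F : fieldType) (n : nat).

(* The arguments l t r b are the left, top, right and bottom colors. *)
Definition gamma_weight (q z : F) (l t r b : color n) : F :=
  if [&& l == t, t == r & r == b] then 1
  else if (l == r) && (t == b) then (if clt l t then z else q * z)
  else if (l == b) && (t == r) then (if clt t l then 1 - q * z else 1 - z)
  else 0.

Definition zprime (q z : F) : F := q + 1 - z^-1.

Definition delta_weight (q z : F) (l t r b : color n) : F :=
  if [&& l == t, t == r & r == b] then 1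
  else if (l == r) && (t == b) then
    (if clt l t then zprime q z else q^-1 * zprime q z)
  else if (l == t) && (r == b) then
    (if clt r l then 1 - zprime q z else 1 - q^-1 * zprime q z)
  else 0.

Definition cap_weight (x y : color n) : F :=
  match x, y with
  | None, None => 1
  | Some a, Some b => if b == bar a then 1 else 0
  | _, _ => 0
  end.

End Weights.

Section Model.

Variables (F : fieldType) (n L : nat) (lam : n.-tuple nat).
Variables (sigma tau : {perm letter n}).

(* For i : 'I_n, standing for i + 1, the row (i, false) is the Delta row
   numbered 2(i+1) - 1 and (i, true) is the Gamma row numbered 2(i+1). *)
Definition row_index : finType := ('I_n * bool)%type.

(* The number of rows below r. *)
Definition rows_below (r : row_index) : nat := (r.1.*2 + r.2)%N.

(* The column c : 'I_L is numbered c + 1, from right to left.  A state colors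
   the horizontal edges (r, k), where k columns lie to the right of the edge,
   and the vertical edges (m, c), where m rows lie below the edge. *)
Definition ice_state : finType :=
  ({ffun row_index * 'I_L.+1 -> color n}
   * {ffun 'I_(n.*2).+1 * 'I_L -> color n})%type.

Implicit Types (s : ice_state) (r : row_index) (c : 'I_L).

Definition left_color s r c : color n := s.1 (r, lift ord0 c).
Definition right_color s r c : color n := s.1 (r, widen_ord (leqnSn L) c).
Definition top_color s r c : color n := s.2 (inord (rows_below r).+1, c).
Definition bottom_color s r c : color n := s.2 (inord (rows_below r), c).

Definition compatible s : bool :=
  [&& [forall i : 'I_n,
         s.1 ((i, true), ord_max) == Some (sigma (pos_letter i))],
      [forall i : 'I_n, s.1 ((i, false), ord_max) == None],
      [forall c : 'I_L, s.2 (ord_max, c) == None],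
      [forall i : 'I_n, forall c : 'I_L,
         (c.+1 == tnth lam i + n - i)%N
           ==> (s.2 (ord0, c) == Some (tau (pos_letter i)))]
    & [forall c : 'I_L,
         [forall i : 'I_n, (c.+1 != tnth lam i + n - i)%N]
           ==> (s.2 (ord0, c) == None)]].

Definition vertex_weight (q : F) (z : {ffun 'I_n -> F}) s r c : F :=
  let l := left_color s r c in let t := top_color s r c in
  let rt := right_color s r c in let b := bottom_color s r c in
  if r.2 then gamma_weight q (z r.1) l t rt b
  else delta_weight q (z r.1) l t rt b.

Definition state_weight (q : F) (z : {ffun 'I_n -> F}) s : F :=
  (\prod_(r : row_index) \prod_(c < L) vertex_weight q z s r c)
  * \prod_(i < n) cap_weight F (s.1 ((i, true), ord0)) (s.1 ((i, false), ord0)).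

Definition partition_function (q : F) (z : {ffun 'I_n -> F}) : F :=
  \sum_(s : ice_state | compatible s) state_weight q z s.

Definition z_of_u (q : F) (u : {ffun 'I_n -> F}) : {ffun 'I_n -> F} :=
  [ffun i => (1 - u i) / (q - u i)].

Definition Ztilde_exponent : nat :=
  (\sum_(i < n) (n - i.+1) * (0 < letter_val (sigma (pos_letter i)))%R
   + L.+1 * \sum_(i < n) (letter_val (sigma (pos_letter i)) < 0)%R)%N.

Definition Ztilde (q : F) (u : {ffun 'I_n -> F}) : F :=
  partition_function q (z_of_u q u)
  * (q ^+ Ztilde_exponent / \prod_(i < n) z_of_u q u i ^+ L).

End Model.

(* The denominators occurring in Ztilde at u do not vanish: those of the change
   of variables (q - u_i and 1 - z_i = (q - 1) / (q - u_i)), q, and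
   z_i = (1 - u_i) / (q - u_i). *)
Definition generic (F : fieldType) (n : nat) (q : F) (u : {ffun 'I_n -> F}) :
    Prop :=
  [/\ q != 0, q != 1 & forall i, u i != q /\ u i != 1].

Lemma z_of_u_inverse (F : fieldType) (n : nat) (q : F)
    (u z : {ffun 'I_n -> F}) :
  (forall i, u i != q) -> (forall i, z i != 1) ->
  z = z_of_u q u <-> u = [ffun i => (1 - q * z i) / (1 - z i)].
Proof.
move=> uq z1.
have uq' i : q - u i != 0 by rewrite subr_eq0 eq_sym.
have z1' i : 1 - z i != 0 by rewrite subr_eq0 eq_sym.
have eq_divf (x y d : F) : d != 0 -> (x == y / d) = (x * d == y).
  by move=> d0; rewrite -(inj_eq (mulIf d0)) mulfVK.
have E i : (z i == (1 - u i) / (q - u i)) = (u i == (1 - q * z i) / (1 - z i)).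
  rewrite !eq_divf // -subr_eq0 -[RHS]subr_eq0.
  by congr (_ == 0); ring.
split=> e; apply/ffunP => i; rewrite !ffunE; apply/eqP.
  by rewrite -E e !ffunE.
by rewrite E e !ffunE.
Qed.

(* Main.v *)
(* All weights are specializations of one stochastic vertex [vtx], cleared of
   denominators: with the spectral parameters [u] for the Gamma line of z_i, 1
   for the columns and 1/(q u) for the Delta line, a crossing of two lines
   depends only on the ratio of their parameters.  One Yang-Baxter equation
   therefore lets Gamma and Delta rows pass through each other.  For two
   neighbouring strips this is done on products Gamma Delta Gamma Delta, and the
   coefficients produced at the caps are recombined by a reflection equation
   ([push_cbar]); comparing the left boundaries gives the recursion for s_i.

   For s_n only the top strip matters.  All its top edges carry +, so its Gamma
   row carries a single path, and it can be replaced by a Delta row in which the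
   roles of path and vacuum at the cap are exchanged.  The parameters of the two
   Delta rows are then exchanged by u_n -> 1/u_n, and the Yang-Baxter equation
   for Delta rows concludes. *)

Require Import Defs.
From mathcomp Require Import all_boot all_order all_algebra all_fingroup.
From mathcomp Require Import ring zify.

Set Implicit Arguments.
Unset Strict Implicit.
Unset Printing Implicit Defensive.
Import Order.TTheory GRing.Theory Num.Theory.
Local Open Scope ring_scope.

(** * Colors *)

Section ColorOrder.
Variable n : nat.
Implicit Types x y : color n.

Lemma color_val_inj : injective (@color_val n).
Proof.
case=> [[[] i]|] [[[] j]|] //=; rewrite /letter_val /= => e; congr Some;
  try (congr pair; apply: val_inj => /=; lia); lia.
Qed.

(** One case split settles the four tests on two colors that occur in the weights and leaves a fact
    on [color_val], from which [lia] refutes inconsistent orders. *)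
Variant color_cmp x y : bool -> bool -> bool -> bool -> Prop :=
| ColorEq of x = y : color_cmp x y true true false false
| ColorLt of color_val x < color_val y : color_cmp x y false false true false
| ColorGt of color_val y < color_val x : color_cmp x y false false false true.

Lemma color_cmpP x y : color_cmp x y (x == y) (y == x) (clt x y) (clt y x).
Proof.
rewrite /clt -!(inj_eq color_val_inj).
by case: ltgtP => h; constructor => //; apply: color_val_inj.
Qed.

(** Fixing + makes the cap condition uniform: the Delta row ends with [cbar] of the color ending the
    Gamma row. *)
Definition cbar x : color n := omap (@bar n) x.

Lemma cbarK : involutive cbar.
Proof. by case=> [[b i]|] //=; rewrite /bar /= negbK. Qed.

Lemma color_val_cbar x : color_val (cbar x) = - color_val x.
Proof. by case: x => [[[] i]|] //=; rewrite /letter_val /= ?opprK. Qed.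

End ColorOrder.

(** * The vertex and the Yang-Baxter equation *)

Section Vertex.
Variables (R : comNzRingType) (n : nat).
Local Notation C := (color n).
Implicit Types (q x y : R) (i j k l : C).

(* The incoming colors are i and j, the outgoing ones are k on the line of i and
   l on the line of j; the ratio of the spectral parameters is x / y. *)
Definition vtx q x y i j k l : R :=
  if i == j then ((k == i) && (l == j))%:R * (q * y - x)
  else ((k == i) && (l == j))%:R * (if clt i j then y - x else q * (y - x))
     + ((k == j) && (l == i))%:R * (q - 1) * (if clt i j then y else x).

(** The contraction of [vtx] with a function of the outgoing colors. At most two terms survive, so
    identities between crossings reduce to a case split on the order of the colors and [ring]. *)
Definition push (V : lmodType R) q x y i j (f : C -> C -> V) : V :=
  if i == j then (q * y - x) *: f i i
  else (if clt i j then y - x else q * (y - x)) *: f i j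
     + ((q - 1) * (if clt i j then y else x)) *: f j i.

Lemma sum_delta2 (V : lmodType R) (c : R) i j (f : C -> C -> V) :
  \sum_k \sum_l (((k == i) && (l == j))%:R * c) *: f k l = c *: f i j.
Proof.
rewrite (bigD1 i) //= [X in _ + X]big1 ?addr0 => [|k /negPf ki]; last first.
  by apply: big1 => l _; rewrite ki mul0r scale0r.
rewrite (bigD1 j) //= big1 ?addr0 => [|l /negPf lj]; first by rewrite !eqxx mul1r.
by rewrite lj andbF mul0r scale0r.
Qed.

Lemma sum_vtx (V : lmodType R) q x y i j (f : C -> C -> V) :
  \sum_k \sum_l vtx q x y i j k l *: f k l = push q x y i j f.
Proof.
rewrite /vtx /push; case: eqP => [->|_]; first exact: sum_delta2.
under eq_bigr do under eq_bigr do rewrite scalerDl -mulrA.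
under eq_bigr do rewrite big_split /=.
by rewrite big_split /= !sum_delta2.
Qed.

Lemma eq_push (V : lmodType R) q x y i j (f g : C -> C -> V) :
  (forall k l, f k l = g k l) -> push q x y i j f = push q x y i j g.
Proof. by move=> e; rewrite /push !e. Qed.

(** Line m has spectral parameter [am / bm], kept as a pair to avoid division. Only the relative
    order of the three colors matters, which leaves finitely many polynomial identities. *)
Lemma push_ybe q a1 a2 a3 b1 b2 b3 i1 i2 i3 (f : C -> C -> C -> R^o) :
  push q (a1 * b2) (b1 * a2) i1 i2 (fun k1 k2 =>
    push q (a1 * b3) (b1 * a3) k1 i3 (fun k1 k3 =>
      push q (a2 * b3) (b2 * a3) k2 k3 (fun k2 k3 => f k1 k2 k3)))
  = push q (a2 * b3) (b2 * a3) i2 i3 (fun k2 k3 =>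
    push q (a1 * b3) (b1 * a3) i1 k3 (fun k1 k3 =>
      push q (a1 * b2) (b1 * a2) k1 k2 (fun k1 k2 => f k1 k2 k3))).
Proof.
rewrite /push /GRing.scale /=.
by repeat (case: color_cmpP; intros; subst; try lia); ring.
Qed.

(* The reflection equation: a cap replaces the color of a path by its opposite,
   which turns a crossing of Gamma rows into the inverse crossing of Delta
   rows. *)
Lemma push_cbar q c x y r s i j (f : C -> C -> R^o) :
  push q x y i j (fun i j => push q r s j (cbar i) (fun k l =>
    push q (c * y) (c * x) l (cbar k) f))
  = (c * (q * x - y) * (q * y - x))
    *: push q r s i (cbar j) (fun k l => f (cbar k) l).
Proof.
rewrite /push /GRing.scale /= !cbarK.
(* The opposites become variables known only through [color_val]; this is enough for [lia] to
   discard the impossible orders of the four colors. *)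
have vi := color_val_cbar i; have vj := color_val_cbar j.
have [eij|/eqP nij] := eqVneq i j; first rewrite eij;
  move: vi vj; move: (cbar i) (cbar j) => i' j' vi vj;
by repeat (case: color_cmpP; intros; subst; try lia); ring.
Qed.

Lemma sum_vtx_mull q x y i j (f : C -> C -> R) :
  \sum_k \sum_l vtx q x y i j k l * f k l = push q x y i j (f : C -> C -> R^o).
Proof. exact: (sum_vtx (V := R^o)). Qed.

Lemma vtx_push q x y i j k l :
  vtx q x y i j k l
  = push q x y i j (fun k' l' => ((k' == k) && (l' == l))%:R : R^o).
Proof.
rewrite -sum_vtx_mull (bigD1 k) //= [X in _ = _ + X]big1 => [|k' /negPf kk].
  rewrite (bigD1 l) //= big1 => [|l' /negPf ll]; last by rewrite ll andbF mulr0.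
  by rewrite !eqxx mulr1 !addr0.
by apply: big1 => l' _; rewrite kk mulr0.
Qed.

Lemma sum_vtx1 q x y i j k (f : C -> R) :
  \sum_l vtx q x y i j k l * f l
  = push q x y i j (fun k' l => (k' == k)%:R * f l : R^o).
Proof.
rewrite -sum_vtx_mull exchange_big /=; apply: eq_bigr => l _.
rewrite (bigD1 k) //= eqxx mul1r big1 ?addr0 // => k' /negPf ->.
by rewrite mul0r mulr0.
Qed.

Lemma sum_vtx2 q x y i j l (f : C -> R) :
  \sum_k vtx q x y i j k l * f k
  = push q x y i j (fun k l' => (l' == l)%:R * f k : R^o).
Proof.
rewrite -sum_vtx_mull; apply: eq_bigr => k _.
rewrite (bigD1 l) //= eqxx mul1r big1 ?addr0 // => l' /negPf ->.
by rewrite mul0r mulr0.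
Qed.

Lemma pushZ (V : lmodType R) q x y i j c (f : C -> C -> V) :
  c *: push q x y i j f = push q x y i j (fun k l => c *: f k l).
Proof.
rewrite /push; case: ifP => _; rewrite ?scalerDr !scalerA;
  by rewrite ![c * _]mulrC.
Qed.

Lemma vtx_ybe q a1 a2 a3 b1 b2 b3 i1 i2 i3 o1 o2 o3 :
  \sum_k1 \sum_k2 vtx q (a1 * b2) (b1 * a2) i1 i2 k1 k2 *
    (\sum_k3 vtx q (a1 * b3) (b1 * a3) k1 i3 o1 k3
       * vtx q (a2 * b3) (b2 * a3) k2 k3 o2 o3)
  = \sum_k2 \sum_k3 vtx q (a2 * b3) (b2 * a3) i2 i3 k2 k3 *
    (\sum_k1 vtx q (a1 * b3) (b1 * a3) i1 k3 k1 o3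
       * vtx q (a1 * b2) (b1 * a2) k1 k2 o1 o2).
Proof.
rewrite !sum_vtx_mull.
(* Both are the indicator of the prescribed outgoing colors, factored as the two sides produce it:
   [f] singles out the first line, [g] the third. *)
pose f k1 k2 k3 : R^o :=
  ((k1 == o1)%:R : R) * (((k2 == o2) && (k3 == o3))%:R : R).
pose g k1 k2 k3 : R^o :=
  ((k3 == o3)%:R : R) * (((k1 == o1) && (k2 == o2))%:R : R).
have fg k1 k2 k3 : f k1 k2 k3 = g k1 k2 k3.
  by rewrite /f /g -!natrM; do 3 case: eqP.
transitivity (push (V:=R^o) q (a1 * b2) (b1 * a2) i1 i2 (fun k1 k2 =>
    push (V:=R^o) q (a1 * b3) (b1 * a3) k1 i3 (fun k1 k3 =>
      push (V:=R^o) q (a2 * b3) (b2 * a3) k2 k3 (fun k2 k3 => f k1 k2 k3)))).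
  apply: (eq_push (V:=R^o)) => k l; rewrite sum_vtx1; apply: eq_push => k' l'.
  by rewrite vtx_push [LHS]pushZ.
rewrite push_ybe. apply: (eq_push (V:=R^o)) => k l.
rewrite sum_vtx2; apply: eq_push => k' l'.
rewrite vtx_push [RHS]pushZ; apply: eq_push => k'' l''; exact: fg.
Qed.

End Vertex.

(** * Rows *)

Section PathSum.
Variable R : comNzRingType.

(** The edge [h k] has k columns to its right, so [ord_max] is the left end of the row and [ord0]
    the right end. *)
Definition pathsum (A : finType) L (T : 'I_L -> A -> A -> R) (l r : A) : R :=
  \sum_(h : {ffun 'I_L.+1 -> A} | (h ord_max == l) && (h ord0 == r))
    \prod_(c < L) T c (h (lift ord0 c)) (h (widen_ord (leqnSn L) c)).

Lemma pathsum0 (A : finType) (T : 'I_0 -> A -> A -> R) l r :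
  pathsum T l r = (l == r)%:R.
Proof.
rewrite /pathsum (reindex (fun a : A => [ffun=> a])) /=; last first.
  exists (fun h : {ffun 'I_1 -> A} => h ord0) => [a _|h _]; first by rewrite ffunE.
  by apply/ffunP => i; rewrite ffunE [i]ord1.
under eq_bigl do rewrite !ffunE.
under eq_bigr do rewrite big_ord0.
have [->|lr] := eqVneq l r; first by rewrite (big_pred1 r) // => a; rewrite /= andbb.
by rewrite big_pred0 // => a; apply: contra_neqF lr => /andP[/eqP<- /eqP].
Qed.

Lemma pathsumS (A : finType) L (T : 'I_L.+1 -> A -> A -> R) l r :
  pathsum T l r
  = \sum_x pathsum (fun c => T (lift ord0 c)) l x * T ord0 x r.
Proof.
pose cons (p : A * {ffun 'I_L.+1 -> A}) : {ffun 'I_L.+2 -> A} :=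
  [ffun i => if unlift ord0 i is Some j then p.2 j else p.1].
have consS p j : cons p (lift ord0 j) = p.2 j by rewrite ffunE liftK.
have cons0 p : cons p ord0 = p.1 by rewrite ffunE unlift_none.
have consM p : cons p ord_max = p.2 ord_max.
  by rewrite -consS; congr (cons p _); apply: val_inj.
rewrite /pathsum (reindex cons) /=; last first.
  exists (fun h => (h ord0, [ffun j => h (lift ord0 j)])) => [[a h] _|h _].
    by rewrite cons0; congr pair; apply/ffunP => j; rewrite ffunE consS.
  by apply/ffunP => i; case: (unliftP ord0 i) => [j|] ->;
    rewrite ?consS ?cons0 ?ffunE.
under eq_bigl do rewrite cons0 consM.
rewrite (eq_bigl (fun p : A * {ffun 'I_L.+1 -> A} =>
  (p.1 == r) && (p.2 ord_max == l))); last by move=> p; rewrite andbC.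
rewrite -(pair_big (fun a => a == r) (fun h : {ffun 'I_L.+1 -> A} => h ord_max == l)
  (fun a h => \prod_(c < L.+1) T c (cons (a, h) (lift ord0 c))
     (cons (a, h) (widen_ord (leqnSn L.+1) c)))) /= big_pred1_eq.
under [RHS]eq_bigr do rewrite mulr_suml big_mkcondr /=.
rewrite exchange_big /=; apply: eq_bigr => h _.
rewrite -big_mkcond (big_pred1 (h ord0)) => [|x]; last by rewrite eq_sym.
rewrite big_ord_recl mulrC consS /=; congr (_ * _).
  apply: eq_bigr => c _; rewrite consS /=; congr (T _ _ _).
  by rewrite -(consS (r, h)); congr (cons _ _); apply: val_inj.
have -> : widen_ord (leqnSn L.+1) ord0 = ord0 by apply: val_inj.
by rewrite cons0.
Qed.

(** The train argument: [X] passes through the columns one at a time, from left to right, the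
    induction peeling off the right-most one. *)
Lemma pathsum_intertwine (A B : finType) L (T : 'I_L -> B -> B -> R)
    (T' : 'I_L -> A -> A -> R) (X : A -> B -> R) :
  (forall c x z, \sum_y X x y * T c y z = \sum_y T' c x y * X y z) ->
  forall x z, \sum_y X x y * pathsum T y z = \sum_y pathsum T' x y * X y z.
Proof.
elim: L T T' => [|L IH] T T' XT x z.
  rewrite (bigD1 z) //= [RHS](bigD1 x) //= !pathsum0 !eqxx mulr1 mul1r.
  rewrite !big1 // => y /negPf yx; rewrite pathsum0; last by rewrite yx mulr0.
  by rewrite eq_sym yx mul0r.
under eq_bigr do rewrite pathsumS mulr_sumr.
under [RHS]eq_bigr do rewrite pathsumS mulr_suml.
rewrite exchange_big [RHS]exchange_big /=.
under eq_bigr do (under eq_bigr do rewrite mulrA; rewrite -mulr_suml).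
under eq_bigr do rewrite (IH _ (fun c => T' (lift ord0 c))) // mulr_suml.
under [RHS]eq_bigr do (under eq_bigr do rewrite -mulrA; rewrite -mulr_sumr -XT mulr_sumr).
rewrite exchange_big /=; apply: eq_bigr => y _; apply: eq_bigr => y' _.
by rewrite mulrA.
Qed.

End PathSum.

Section Rows.
Variables (R : comNzRingType) (n L : nat).
Local Notation C := (color n).
Local Notation S := {ffun 'I_L -> C}.
Implicit Types (w : C -> C -> C -> C -> R).

(** Rows of the matrix are indexed by the top colors and columns by the bottom ones, so a matrix
    product lists lattice rows from top to bottom. *)
Definition rowmx w l r : 'M[R]_#|{: S}| :=
  \matrix_(s, t) pathsum
    (fun c x y => w x ((enum_val s : S) c) y ((enum_val t : S) c)) l r.

(** Two stacked rows form one row whose horizontal colors are pairs, the edges between them being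
    summed column by column; the train argument then applies to pairs of rows. *)
Lemma mul_rowmx w1 w2 l1 l2 r1 r2 s t :
  (rowmx w1 l1 r1 *m rowmx w2 l2 r2) s t
  = pathsum (fun c (x y : C * C) =>
      \sum_m w1 x.1 ((enum_val s : S) c) y.1 m * w2 x.2 m y.2 ((enum_val t : S) c))
      (l1, l2) (r1, r2).
Proof.
rewrite mxE.
pose F m := (pathsum (fun c x y => w1 x ((enum_val s : S) c) y (m c)) l1 r1) *
  (pathsum (fun c x y => w2 x (m c) y ((enum_val t : S) c)) l2 r2).
transitivity (\sum_(m : S) F m).
  by rewrite (big_enum_val (A := {: S})) /=; apply: eq_bigr => k _; rewrite !mxE.
rewrite /pathsum (reindex (fun p : {ffun 'I_L.+1 -> C} * {ffun 'I_L.+1 -> C} =>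
   [ffun c => (p.1 c, p.2 c)])) /=; last first.
  exists (fun h => ([ffun c => (h c).1], [ffun c => (h c).2])) => [[h1 h2] _|h _].
    by congr pair; apply/ffunP => c; rewrite !ffunE.
  by apply/ffunP => c; rewrite !ffunE /=; case: (h c).
under [RHS]eq_bigr do rewrite bigA_distr_bigA.
rewrite exchange_big /=; apply: eq_bigr => m _.
rewrite /F /pathsum mulr_suml.
under [LHS]eq_bigr do rewrite mulr_sumr.
rewrite pair_big /=; apply: eq_big => [p|p _].
  by rewrite !ffunE !xpair_eqE andbACA.
by rewrite -big_split; apply: eq_bigr => c _; rewrite !ffunE.
Qed.

Lemma rowmx_exchange w1 w2 w1' w2' (X : C -> C -> C -> C -> R) :
  (forall t b x1 x2 z1 z2,
     \sum_y1 \sum_y2 X x1 x2 y1 y2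
       * (\sum_m w1 y1 t z1 m * w2 y2 m z2 b)
     = \sum_y1 \sum_y2 (\sum_m w1' x1 t y1 m * w2' x2 m y2 b)
       * X y1 y2 z1 z2) ->
  forall x1 x2 z1 z2,
    \sum_y1 \sum_y2 X x1 x2 y1 y2 *: (rowmx w1 y1 z1 *m rowmx w2 y2 z2)
    = \sum_y1 \sum_y2 X y1 y2 z1 z2
        *: (rowmx w1' x1 y1 *m rowmx w2' x2 y2).
Proof.
move=> XT x1 x2 z1 z2; apply/matrixP => s t; rewrite !pair_bigA !summxE /=.
pose X' (x y : C * C) := X x.1 x.2 y.1 y.2.
pose T w w' c (x y : C * C) := \sum_m w x.1 ((enum_val s : S) c) y.1 m
  * w' x.2 m y.2 ((enum_val t : S) c).
transitivity (\sum_y X' (x1, x2) y * pathsum (T w1 w2) y (z1, z2)).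
  by apply: eq_bigr => -[y1 y2] _; rewrite mxE mul_rowmx.
rewrite (pathsum_intertwine (T' := T w1' w2')) => [|c [a1 a2] [b1 b2]].
  by apply: eq_bigr => -[y1 y2] _; rewrite mxE mul_rowmx mulrC.
have := XT ((enum_val s : S) c) ((enum_val t : S) c) a1 a2 b1 b2.
by rewrite !pair_bigA.
Qed.

End Rows.

(** * Exchange relations *)

Section DoubleRows.
Variables (R : comNzRingType) (n L : nat).
Local Notation C := (color n).
Implicit Types (q x y : R) (i j k l : C).

Definition gammamx q x y l r := rowmx L (@vtx R n q x y) l r.

(* The Delta paths run from right and top to left and bottom, and the column
   lies to the right of a Delta line in the direction of the paths. *)
Definition deltamx q x y l r :=
  rowmx L (fun l t r b : C => vtx q x y t r b l) l r.

Lemma gammamx_exchange q x y x' y' l l' r r' :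
  \sum_k \sum_k' vtx q (x * y') (y * x') l l' k k'
    *: (gammamx q x y k r *m gammamx q x' y' k' r')
  = \sum_k \sum_k' vtx q (x * y') (y * x') k k' r r'
    *: (gammamx q x' y' l' k' *m gammamx q x y l k).
Proof.
rewrite [RHS]exchange_big /=.
apply: (rowmx_exchange L (X := fun a b => vtx q (x * y') (y * x') b a)).
move=> t b a1 a2 b1 b2.
(* The column is the third line, with parameter 1 / 1. *)
have := vtx_ybe q x x' 1 y y' 1 a2 a1 t b1 b2 b; rewrite !mulr1 => ->.
rewrite [RHS]pair_bigA [LHS]exchange_big /=.
under [RHS]eq_bigr do rewrite mulr_suml.
rewrite -(pair_bigA _ (fun a c => \sum_m vtx q x' y' a1 t a m
  * vtx q x y a2 m c b * vtx q (x * y') (y * x') c a b1 b2)) /=.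
rewrite [LHS]exchange_big; apply: eq_bigr => k _.
rewrite [RHS]exchange_big; apply: eq_bigr => m _; rewrite mulr_sumr.
by apply: eq_bigr => k' _; rewrite mulrA.
Qed.

Lemma deltamx_exchange q x y x' y' l l' r r' :
  \sum_k \sum_k' vtx q (y * x') (x * y') k k' l l'
    *: (deltamx q x y k r *m deltamx q x' y' k' r')
  = \sum_k \sum_k' vtx q (y * x') (x * y') r r' k k'
    *: (deltamx q x' y' l' k' *m deltamx q x y l k).
Proof.
rewrite [RHS]exchange_big /=.
apply: (rowmx_exchange L
  (X := fun a b c d => vtx q (y * x') (x * y') c d b a)).
move=> t b a1 a2 b1 b2.
(* The column is now the first line, and a Delta line carries the inverse parameter [y / x]. *)
have := vtx_ybe q 1 y y' 1 x x' t b1 b2 b a2 a1; rewrite !mul1r => e.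
transitivity (\sum_m \sum_y1 vtx q x y t b1 m y1 *
  (\sum_y2 vtx q x' y' m b2 b y2 * vtx q (y * x') (x * y') y1 y2 a2 a1)).
  rewrite [RHS]exchange_big; apply: eq_bigr => y1 _ /=.
  under [RHS]eq_bigr do rewrite mulr_sumr.
  rewrite [RHS]exchange_big; apply: eq_bigr => y2 _ /=.
  by rewrite mulr_sumr; apply: eq_bigr => m _; ring.
rewrite e [LHS]exchange_big; apply: eq_bigr => y1 _ /=; apply: eq_bigr => y2 _.
by rewrite mulr_sumr mulr_suml; apply: eq_bigr => m _; ring.
Qed.

Lemma gamma_deltamx_exchange q x y x' y' l l' r r' :
  \sum_k \sum_k' vtx q (x * x') (y * y') l k' k l'
    *: (deltamx q x' y' k' r' *m gammamx q x y k r)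
  = \sum_k \sum_k' vtx q (x * x') (y * y') k r' r k'
    *: (gammamx q x y l k *m deltamx q x' y' l' k').
Proof.
rewrite [LHS]exchange_big /=.
apply: (rowmx_exchange L
  (X := fun a b c d => vtx q (x * x') (y * y') a c d b)).
move=> t b a1 a2 b1 b2.
(* The lines are, in order, Gamma with [x / y], the column, and Delta with [y' / x']. *)
have := vtx_ybe q x 1 y' y 1 x' a1 t b1 b2 b a2; rewrite !mulr1 !mul1r => e.
transitivity (\sum_m \sum_y1 vtx q x' y' t b1 m y1 *
  (\sum_y2 vtx q (x * x') (y * y') a1 y1 y2 a2 * vtx q x y y2 m b2 b)).
  rewrite [RHS]exchange_big; apply: eq_bigr => y1 _ /=.
  under [RHS]eq_bigr do rewrite mulr_sumr.
  rewrite [RHS]exchange_big; apply: eq_bigr => y2 _ /=.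
  by rewrite mulr_sumr; apply: eq_bigr => m _; ring.
rewrite -e; apply: eq_bigr => y1 _ /=.
under eq_bigr do rewrite mulr_sumr.
rewrite exchange_big; apply: eq_bigr => y2 _ /=.
by rewrite mulr_suml; apply: eq_bigr => m _; ring.
Qed.

Lemma vtx_eq_out q x y k k' l :
  vtx q x y k k' l l = ((k == l) && (k' == l))%:R * (q * y - x).
Proof.
rewrite /vtx ![l == _]eq_sym; have [->|kk'] := eqVneq k k'; first by [].
have kl : (k == l) && (k' == l) = false.
  by apply: contra_neqF kk' => /andP[/eqP-> /eqP->].
by rewrite [in X in _ + X]andbC kl !mul0r addr0.
Qed.

(** Both left edges carry +, and equal outgoing colors force equal incoming ones, so the crossing on
    the left is a scalar. *)
Lemma deltamx_push q x y x' y' r r' :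
  (q * (x * y') - y * x')
    *: (deltamx q x y None r *m deltamx q x' y' None r')
  = push q (y * x') (x * y') r r' (fun k k' =>
      deltamx q x' y' None k' *m deltamx q x y None k).
Proof.
rewrite -sum_vtx -deltamx_exchange.
under eq_bigr do under eq_bigr do rewrite vtx_eq_out.
by rewrite sum_delta2.
Qed.

Definition gd_factor q x y (a : C) : R := vtx q x y a None a None.

(** Colors are conserved and + leaves on the second line, so the path [a] can only go straight. *)
Lemma vtx_None_out q x y (a : letter n) k k' :
  vtx q x y (Some a) k' k None
  = ((k == Some a) && (k' == None))%:R * gd_factor q x y (Some a).
Proof.
rewrite /gd_factor /vtx [None == _]eq_sym [None == Some a]/=.
by case: k' => [b|]; case: ifP => _ //=; rewrite ?andbF ?eqxx ?mul0r ?addr0 ?mul1r.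
Qed.

(** [F r] is whatever lies below and depends on the right end of the Gamma row. The crossing on the
    left is the scalar [gd_factor]; the one on the right acts between the rows and their caps. *)
Lemma delta_gamma_push q x y x' y' (a : letter n) r' p
    (F : C -> 'M_(#|{: {ffun 'I_L -> C}}|, p)) :
  gd_factor q (x * x') (y * y') (Some a)
    *: \sum_r (deltamx q x' y' None r' *m gammamx q x y (Some a) r *m F r)
  = \sum_k gammamx q x y (Some a) k *m push q (x * x') (y * y') k r'
      (fun r k' => deltamx q x' y' None k' *m F r).
Proof.
transitivity (\sum_r (\sum_k \sum_k' vtx q (x * x') (y * y') k r' r k'
    *: (gammamx q x y (Some a) k *m deltamx q x' y' None k')) *m F r).
  rewrite scaler_sumr; apply: eq_bigr => r _.
  rewrite -gamma_deltamx_exchange scalemxAl; congr (_ *m _).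
  under [RHS]eq_bigr do under eq_bigr do rewrite vtx_None_out.
  by rewrite sum_delta2.
under eq_bigr do rewrite mulmx_suml.
rewrite exchange_big; apply: eq_bigr => k _ /=.
rewrite -sum_vtx mulmx_sumr; apply: eq_bigr => r _.
rewrite mulmx_suml mulmx_sumr; apply: eq_bigr => k' _.
by rewrite -scalemxAl -scalemxAr mulmxA.
Qed.

(** A strip with its cap at u = [x / y]; the ratio [q * x / y] of the Delta row is that of a column
    of parameter 1 to a line of parameter 1/(qu). *)
Definition dblmx q x y l :=
  \sum_k gammamx q x y l k *m deltamx q (q * x) y None (cbar k).

(** Sorts Gamma Delta Gamma Delta into Gamma Gamma Delta Delta, at the price of one crossing joining
    the two caps. *)
Lemma mul_dblmx q x y x' y' l (a : letter n) :
  gd_factor q (x * (q * x')) (y * y') (Some a)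
    *: (dblmx q x' y' l *m dblmx q x y (Some a))
  = \sum_k' \sum_k gammamx q x' y' l k' *m gammamx q x y (Some a) k *m
      push q (x * (q * x')) (y * y') k (cbar k') (fun r d =>
        deltamx q (q * x') y' None d *m deltamx q (q * x) y None (cbar r)).
Proof.
rewrite /dblmx mulmx_suml scaler_sumr; apply: eq_bigr => k' _.
rewrite -mulmxA scalemxAr mulmx_sumr.
under [X in _ *: X]eq_bigr do rewrite mulmxA.
rewrite delta_gamma_push mulmx_sumr; apply: eq_bigr => k _.
by rewrite mulmxA.
Qed.

Lemma eq_push_in (V : lmodType R) q x y i j (f g : C -> C -> V) :
  f i j = g i j -> f j i = g j i -> push q x y i j f = push q x y i j g.
Proof. by rewrite /push; case: eqP => [->|_] -> // ->. Qed.

Lemma push_mx q x y i j p r (f : C -> C -> 'M[R]_(p, r)) s t :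
  (push q x y i j f) s t = push q x y i j (fun k l => f k l s t : R^o).
Proof. by rewrite /push; case: ifP => _; rewrite !mxE. Qed.

Lemma push_cbar_mx q c x y r s i j p p' (f : C -> C -> 'M[R]_(p, p')) :
  push q x y i j (fun i j => push q r s j (cbar i) (fun k l =>
    push q (c * y) (c * x) l (cbar k) f))
  = (c * (q * x - y) * (q * y - x))
    *: push q r s i (cbar j) (fun k l => f (cbar k) l).
Proof.
apply/matrixP => u v; rewrite mxE !push_mx.
rewrite -[RHS](push_cbar _ _ _ _ _ _ _ _ (fun k l => f k l u v)).
apply: (eq_push (V := R^o)) => k l; rewrite push_mx.
by apply: (eq_push (V := R^o)) => k' l'; rewrite push_mx.
Qed.

Lemma push_sum (V : lmodType R) (I : finType) q x y i j (f : I -> C -> C -> V) :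
  push q x y i j (fun k l => \sum_a f a k l) = \sum_a push q x y i j (f a).
Proof.
by rewrite /push; case: ifP => _; rewrite ?big_split -!scaler_sumr.
Qed.

Lemma push_mulmx q x y i j m p r (f : C -> C -> 'M[R]_(m, p)) (A : 'M_(p, r)) :
  push q x y i j (fun k l => f k l *m A) = push q x y i j f *m A.
Proof. by rewrite /push; case: ifP => _; rewrite ?mulmxDl -!scalemxAl. Qed.

Lemma sum_vtx_mulmx q x y m p r (W : C -> C -> 'M[R]_(m, p))
    (H : C -> C -> 'M_(p, r)) :
  \sum_k \sum_l (\sum_i \sum_j vtx q x y i j k l *: W i j) *m H k l
  = \sum_i \sum_j W i j *m push q x y i j H.
Proof.
transitivity (\sum_k \sum_l \sum_i \sum_j
    W i j *m (vtx q x y i j k l *: H k l)).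
  apply: eq_bigr => k _; apply: eq_bigr => l _.
  rewrite mulmx_suml; apply: eq_bigr => i _.
  by rewrite mulmx_suml; apply: eq_bigr => j _; rewrite -scalemxAl -scalemxAr.
rewrite pair_bigA [RHS]pair_bigA /=; under eq_bigr do rewrite pair_bigA /=.
rewrite exchange_big; apply: eq_bigr => -[i j] _ /=.
by rewrite -sum_vtx pair_bigA mulmx_sumr.
Qed.

(** The outer scalar on the left comes from exchanging the Delta rows, the [gd_factor]s from sorting
    each product, and the scalar on the right from the reflection equation. *)
Lemma dblmx_exchange q x y x' y' (a b : letter n) :
  push q (x' * y) (y' * x) (Some b) (Some a) (fun j i =>
    (q * (q * x' * y) - y' * (q * x)) *:
    (gd_factor q (x * (q * x')) (y * y') i
       *: (dblmx q x' y' j *m dblmx q x y i)))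
  = (q * (q * (x' * y) - y' * x) * (q * (y' * x) - x' * y))
    *: (gd_factor q (x * (q * x')) (y * y') (Some b)
      *: (dblmx q x y (Some a) *m dblmx q x' y' (Some b))).
Proof.
have swapX : x * (q * x') = x' * (q * x) by ring.
pose G l := gammamx q x y l; pose G' l := gammamx q x' y' l.
(* [H] is the Delta half of the left side once its Delta rows are in the order of the right side,
   with the two crossings this creates at the caps. *)
pose H k' k := push q (x * (q * x')) (y * y') k (cbar k') (fun r d =>
  push q (q * (y' * x)) (q * (x' * y)) d (cbar r) (fun d r =>
    deltamx q (q * x) y None r *m deltamx q (q * x') y' None d)).
have E l (c : letter n) :
    (q * (q * x' * y) - y' * (q * x)) *:
    (gd_factor q (x * (q * x')) (y * y') (Some c)
      *: (dblmx q x' y' l *m dblmx q x y (Some c)))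
    = \sum_k' \sum_k (G' l k' *m G (Some c) k) *m H k' k.
  rewrite mul_dblmx scaler_sumr; apply: eq_bigr => k' _.
  rewrite scaler_sumr; apply: eq_bigr => k _.
  rewrite scalemxAr pushZ; congr (_ *m _); apply: eq_push => r d.
  by rewrite deltamx_push -!mulrA [y' * (q * x)]mulrCA.
transitivity (push q (x' * y) (y' * x) (Some b) (Some a) (fun j i =>
    \sum_k' \sum_k (G' j k' *m G i k) *m H k' k)).
  by apply: eq_push_in; exact: E.
rewrite push_sum; under eq_bigr do rewrite push_sum.
under eq_bigr do under eq_bigr do
  rewrite push_mulmx -sum_vtx (gammamx_exchange q x' y' x y).
rewrite sum_vtx_mulmx [y * y']mulrC swapX mul_dblmx exchange_big scaler_sumr /=.
apply: eq_bigr => k _; rewrite scaler_sumr; apply: eq_bigr => k' _.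
rewrite scalemxAr -[X in _ = _ *m X]
  (push_cbar_mx _ _ _ _ _ _ _ _ (fun r d =>
     deltamx q (q * x) y None d *m deltamx q (q * x') y' None r)).
by rewrite /H swapX [y * y']mulrC.
Qed.

End DoubleRows.

(** * The partition function as a product of transfer matrices *)

Section StateSum.
Variables (F : fieldType) (n L : nat) (lam : n.-tuple nat).
Variables (sigma tau : {perm letter n}) (q : F) (z : {ffun 'I_n -> F}).
Local Notation C := (color n).
Local Notation S := {ffun 'I_L -> C}.
Local Notation H := {ffun 'I_L.+1 -> C}.

Definition bottom_ok (b : S) : bool :=
  [forall i : 'I_n, forall c : 'I_L,
     (c.+1 == tnth lam i + n - i)%N ==> (b c == Some (tau (pos_letter i)))]
  && [forall c : 'I_L,
     [forall i : 'I_n, (c.+1 != tnth lam i + n - i)%N] ==> (b c == None)].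

Definition strips : finType :=
  ({ffun 'I_n -> H * H * S} * {ffun 'I_n.+1 -> S})%type.

(* The vertical edges are cut into the levels between consecutive strips (p.2)
   and the levels inside the strips, between a Delta and a Gamma row (p.1). *)
Definition state_of_strips (p : strips) : ice_state n L :=
  ([ffun e : row_index n * 'I_L.+1 =>
      if e.1.2 then (p.1 e.1.1).1.1 e.2 else (p.1 e.1.1).1.2 e.2],
   [ffun e : 'I_(n.*2).+1 * 'I_L => if odd e.1
      then oapp (fun i => (p.1 i).2 e.2) None (insub (e.1)./2)
      else p.2 (inord (e.1)./2) e.2]).

Definition strips_of_state (s : ice_state n L) : strips :=
  ([ffun i => ([ffun k => s.1 ((i, true), k)], [ffun k => s.1 ((i, false), k)],
      [ffun c => s.2 (inord i.*2.+1, c)])],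
   [ffun k : 'I_n.+1 => [ffun c => s.2 (inord k.*2, c)]]).

Lemma state_of_strips_even p (k : 'I_n.+1) c :
  (state_of_strips p).2 (inord k.*2, c) = p.2 k c.
Proof.
have kn : (k.*2 < (n.*2).+1)%N by rewrite ltnS leq_double -ltnS.
by rewrite ffunE /= inordK // odd_double doubleK inord_val.
Qed.

Lemma state_of_strips_odd p (i : 'I_n) c :
  (state_of_strips p).2 (inord i.*2.+1, c) = (p.1 i).2 c.
Proof.
have kn : (i.*2.+1 < (n.*2).+1)%N by rewrite ltnS ltn_double.
by rewrite ffunE /= inordK //= odd_double /= uphalf_double valK.
Qed.

Lemma state_of_stripsK : cancel state_of_strips strips_of_state.
Proof.
move=> p; rewrite [RHS]surjective_pairing; congr pair; apply/ffunP => i.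
  rewrite ffunE; case Ei: (p.1 i) => [[h h'] o].
  congr (_, _, _); apply/ffunP => k; rewrite ffunE.
  - by rewrite ffunE /= Ei.
  - by rewrite ffunE /= Ei.
  - by rewrite state_of_strips_odd Ei.
by rewrite ffunE; apply/ffunP => c; rewrite ffunE state_of_strips_even.
Qed.

Lemma strips_of_stateK : cancel strips_of_state state_of_strips.
Proof.
move=> s.
have E (m : 'I_(n.*2).+1) c :
    (state_of_strips (strips_of_state s)).2 (m, c) = s.2 (m, c).
  rewrite ffunE /=; have := odd_double_half m.
  have := ltn_ord m; rewrite ltnS => mn.
  case: (odd m) => /= em.
    case: insubP => [i _ Ei|] /=; last by rewrite -leqNgt => h; exfalso; lia.
    rewrite !ffunE /= ?ffunE; congr (s.2 (_, _)); apply: val_inj.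
    by have := ltn_ord i; move: Ei => /= Ei li; rewrite inordK; lia.
  rewrite !ffunE /= ?ffunE; congr (s.2 (_, _)); apply: val_inj.
  by rewrite /= !inordK; lia.
rewrite [RHS]surjective_pairing; congr pair; apply/ffunP; last by case.
by case=> -[i []] k; rewrite ffunE /= ?ffunE /= ?ffunE.
Qed.

Definition strip_mx (wG wD : C -> C -> C -> C -> F) (l : C) :
    'M[F]_#|{: S}| :=
  \sum_k rowmx L wG l k *m rowmx L wD None (cbar k).

Definition strip_weight (i : 'I_n) (t b : S) (x : H * H * S) : F :=
  (\prod_(c < L) gamma_weight q (z i) (x.1.1 (lift ord0 c)) (t c)
                  (x.1.1 (widen_ord (leqnSn L) c)) (x.2 c))
  * (\prod_(c < L) delta_weight q (z i) (x.1.2 (lift ord0 c)) (x.2 c)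
                  (x.1.2 (widen_ord (leqnSn L) c)) (b c))
  * cap_weight F (x.1.1 ord0) (x.1.2 ord0).

Lemma cap_weightE (x y : C) : cap_weight F x y = (y == cbar x)%:R.
Proof. by case: x y => [a|] [b|] //=; rewrite -mulrb. Qed.

Lemma strip_mxE l (i : 'I_n) (t b : S) :
  strip_mx (gamma_weight q (z i)) (delta_weight q (z i)) l
    (enum_rank t) (enum_rank b)
  = \sum_(x : H * H * S | (x.1.1 ord_max == l) && (x.1.2 ord_max == None))
      strip_weight i t b x.
Proof.
pose g (m : S) (h : H) := \prod_(c < L) gamma_weight q (z i) (h (lift ord0 c))
  (t c) (h (widen_ord (leqnSn L) c)) (m c).
pose d (m : S) (h : H) := \prod_(c < L) delta_weight q (z i) (h (lift ord0 c))
  (m c) (h (widen_ord (leqnSn L) c)) (b c).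
transitivity (\sum_m (\sum_(h : H | h ord_max == l)
    \sum_(h' : H | h' ord_max == None)
      g m h * d m h' * cap_weight F (h ord0) (h' ord0))); last first.
  rewrite exchange_big /=.
  under eq_bigr do rewrite exchange_big /=.
  rewrite pair_big /= pair_big_dep /=.
  by apply: eq_bigl => -[[h h'] m] /=; rewrite andbT.
rewrite summxE.
under eq_bigr do rewrite mxE.
rewrite exchange_big (big_enum_val (A := {: S})) /=; apply: eq_bigr => m _.
set m' := enum_val m.
transitivity (\sum_k (\sum_(h : H | (h ord_max == l) && (h ord0 == k)) g m' h)
  * (\sum_(h : H | (h ord_max == None) && (h ord0 == cbar k)) d m' h)).
  by apply: eq_bigr => k _; rewrite !mxE /pathsum !enum_rankK.
rewrite [RHS](partition_big (fun h : H => h ord0) xpredT) //=.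
apply: eq_bigr => k _; rewrite mulr_suml; apply: eq_bigr => h /andP[_ /eqP hk].
rewrite mulr_sumr big_mkcondr /=; apply: eq_bigr => h' _.
by rewrite cap_weightE hk -mulrb; case: eqP => _; rewrite ?mulr1 ?mulr0.
Qed.

(** Once the levels [w] between strips are fixed, the contents of different strips are independent,
    so the sum over states factors strip by strip. *)
Lemma partition_functionE :
  partition_function L lam sigma tau q z
  = \sum_(w : {ffun 'I_n.+1 -> S} |
         (w ord_max == [ffun=> None]) && bottom_ok (w ord0))
      \prod_(i < n) \sum_(x : H * H * S |
          (x.1.1 ord_max == Some (sigma (pos_letter i)))
          && (x.1.2 ord_max == None))
        strip_weight i (w (lift ord0 i)) (w (widen_ord (leqnSn n) i)) x.
Proof.
under [RHS]eq_bigr do rewrite bigA_distr_big_dep.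
rewrite pair_big_dep /partition_function.
rewrite (reindex (fun p : {ffun 'I_n.+1 -> S} * {ffun 'I_n -> H * H * S} =>
  state_of_strips (p.2, p.1))) /=; last first.
  exists (fun s => let p := strips_of_state s in (p.2, p.1)) => [[w x] _|s _].
    by rewrite state_of_stripsK.
  by rewrite -surjective_pairing strips_of_stateK.
apply: eq_big => [[w x]|[w x] _] /=.
  rewrite /compatible; set p := (x, w).
  have top c : (state_of_strips p).2 (ord_max, c) = w ord_max c.
    rewrite -(state_of_strips_even p ord_max); congr ((state_of_strips p).2 (_, _)).
    by apply: val_inj; rewrite /= inordK.
  have bot c : (state_of_strips p).2 (ord0, c) = w ord0 c.
    rewrite -(state_of_strips_even p ord0); congr ((state_of_strips p).2 (_, _)).
    by apply: val_inj; rewrite /= inordK.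
  rewrite [LHS]andbA [LHS]andbC. congr (_ && _ && _).
  - apply/forallP/eqP => [h|h c]; last by rewrite top h ffunE.
    by apply/ffunP => c; rewrite ffunE -top; apply/eqP/h.
  - by congr (_ && _); apply: eq_forallb => i; last congr (_ ==> _);
      rewrite ?bot //; apply: eq_forallb => c; rewrite bot.
  - apply/andP/familyP => [[/forallP hG /forallP hD] i|h].
      by have := hG i; have := hD i; rewrite !ffunE /= => ? ?; apply/andP.
    by split; apply/forallP => i; have /andP[] := h i; rewrite ffunE.
have -> : state_weight q z (state_of_strips (x, w)) = \prod_(i < n)
    ((\prod_(b : bool) \prod_(c < L)
       vertex_weight q z (state_of_strips (x, w)) (i, b) c)
     * cap_weight F ((x i).1.1 ord0) ((x i).1.2 ord0)).
  rewrite big_split pair_bigA; congr (_ * _).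
    by apply: eq_bigr => -[].
  by apply: eq_bigr => i _; rewrite !ffunE.
apply: eq_bigr => i _; rewrite big_bool /=.
have topG c : top_color (state_of_strips (x, w)) (i, true) c = w (lift ord0 i) c.
  rewrite /top_color /rows_below -(state_of_strips_even (x, w) (lift ord0 i)).
  by congr ((state_of_strips (x, w)).2 (inord _, c)); rewrite /= addn1.
have mid c : (state_of_strips (x, w)).2 (inord (rows_below (i, true)), c) = (x i).2 c.
  by rewrite -(state_of_strips_odd (x, w)) /rows_below addn1.
have topD c : top_color (state_of_strips (x, w)) (i, false) c = (x i).2 c.
  by rewrite /top_color -mid /rows_below /= addn0 addn1.
have botD c : bottom_color (state_of_strips (x, w)) (i, false) c
    = w (widen_ord (leqnSn n) i) c.
  rewrite /bottom_color /rows_below /= addn0.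
  by rewrite -(state_of_strips_even (x, w) (widen_ord (leqnSn n) i)).
congr (_ * _ * _); apply: eq_bigr => c _; rewrite /vertex_weight /=.
  by rewrite /left_color /right_color /bottom_color topG mid !ffunE.
by rewrite /left_color /right_color topD botD !ffunE.
Qed.

(** The product of the [M i], largest index first, between [top] and the bottoms allowed by [bot].
    The expanded form lets two neighbouring factors, or the top one, be replaced alone. *)
Definition transfer (M : 'I_n -> 'M[F]_#|{: S}|) (top : S) (bot : pred S) : F :=
  \sum_(w : {ffun 'I_n.+1 -> S} | (w ord_max == top) && bot (w ord0))
    \prod_(i < n) M i (enum_rank (w (lift ord0 i)))
                      (enum_rank (w (widen_ord (leqnSn n) i))).

Lemma partition_function_transfer :
  partition_function L lam sigma tau q z
  = transfer (fun i => strip_mx (gamma_weight q (z i)) (delta_weight q (z i))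
                         (Some (sigma (pos_letter i))))
      [ffun=> None] bottom_ok.
Proof.
rewrite partition_functionE; apply: eq_bigr => w _; apply: eq_bigr => i _.
by rewrite strip_mxE.
Qed.

End StateSum.

(** * Exchange of two strips *)

Section Cancel.
Variables (n L : nat).
Local Notation C := (color n).

(** The part of [gd_factor] that depends on the color; the powers of q in [Ztilde] attached to
    positive letters compensate it. *)
Definition sgn_factor (R : comNzRingType) (q : R) (a : letter n) : R :=
  if clt (Some a) None then 1 else q.

Lemma gd_factorE (R : comNzRingType) (q x y : R) a :
  gd_factor q x y (Some a) = (y - x) * sgn_factor q a.
Proof.
rewrite /gd_factor /sgn_factor /vtx /= !eqxx mul1r !mul0r addr0.
by case: ifP => _; rewrite ?mulr1 // mulrC.
Qed.

(** This is [dblmx_exchange] at [y = y' = 1], divided by the common factor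
    [q * (q * x' - x) * (1 - x * (q * x'))]. *)
Lemma dblmx_exchange_idomain (R : idomainType) (q x x' : R) (a b : letter n) :
  q != 0 -> q * x' - x != 0 -> 1 - x * (q * x') != 0 ->
  clt (Some b) (Some a) ->
  (x - x')
    *: (sgn_factor q a *: (dblmx L q x' 1 (Some b) *m dblmx L q x 1 (Some a)))
  + ((q - 1) * x)
    *: (sgn_factor q b *: (dblmx L q x' 1 (Some a) *m dblmx L q x 1 (Some b)))
  = (q * x - x')
    *: (sgn_factor q b *: (dblmx L q x 1 (Some a) *m dblmx L q x' 1 (Some b))).
Proof.
move=> q0 qx0 qxx0 ltba.
have := dblmx_exchange L q x 1 x' 1 a b.
rewrite /push ltba; case: eqP => [e|_]; first by rewrite e /clt ltxx in ltba.
rewrite !gd_factorE.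
move: (dblmx _ _ _ _ (Some b) *m _) (dblmx _ _ _ _ (Some a) *m _).
move: (_ *m dblmx _ _ _ _ (Some b)) => P1 P2 P3.
move=> /matrixP e; apply/matrixP => s t; have {e} := e s t.
rewrite !mxE => e.
have K0 : q * (q * x' - x) * (1 - x * (q * x')) != 0 by rewrite !mulf_neq0.
apply: (mulfI K0); move: e.
set c1 := sgn_factor q a; set c2 := sgn_factor q b; move: c1 c2 => c1 c2 e.
by apply: etrans (etrans e _); ring.
Qed.

Lemma map_rowmx (R R' : comNzRingType) (f : {rmorphism R -> R'}) w l r :
  map_mx f (rowmx L w l r) = rowmx L (fun i j k l : C => f (w i j k l)) l r.
Proof.
apply/matrixP => s t; rewrite !mxE /pathsum rmorph_sum.
by apply: eq_bigr => h _; rewrite rmorph_prod.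
Qed.

Lemma rmorph_vtx (R R' : comNzRingType) (f : {rmorphism R -> R'}) q x y
    (i j k l : C) :
  f (vtx q x y i j k l) = vtx (f q) (f x) (f y) i j k l.
Proof.
rewrite /vtx; case: ifP => _; case: (clt i j);
  by rewrite !(rmorphB, rmorphD, rmorphM, rmorph_nat, rmorph1).
Qed.

Lemma eq_rowmx (R : comNzRingType) (w w' : C -> C -> C -> C -> R) l r :
  (forall i j k l, w i j k l = w' i j k l) -> rowmx L w l r = rowmx L w' l r.
Proof.
move=> e; apply/matrixP => s t; rewrite !mxE; apply: eq_bigr => h _.
by apply: eq_bigr => c _; exact: e.
Qed.

Lemma map_dblmx (R R' : comNzRingType) (f : {rmorphism R -> R'}) q x y (l : C) :
  map_mx f (dblmx L q x y l) = dblmx L (f q) (f x) (f y) l.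
Proof.
rewrite /dblmx raddf_sum; apply: eq_bigr => k _ /=.
rewrite map_mxM !map_rowmx -rmorphM.
by congr (_ *m _); apply: eq_rowmx => *; rewrite rmorph_vtx.
Qed.

Lemma map_linear_mulmx (R R' : comNzRingType) (f : {rmorphism R -> R'}) m
    (c1 c2 c3 : R) (A1 A2 A3 B1 B2 B3 : 'M[R]_m) :
  c1 *: (A1 *m B1) + c2 *: (A2 *m B2) = c3 *: (A3 *m B3) ->
  f c1 *: (map_mx f A1 *m map_mx f B1) + f c2 *: (map_mx f A2 *m map_mx f B2)
  = f c3 *: (map_mx f A3 *m map_mx f B3).
Proof. by rewrite -!map_mxM -!map_mxZ -map_mxD => ->. Qed.

(** The divided identity is carried along a ring morphism, even one that kills the factor divided
    out. *)
Lemma dblmx_exchange_lift (R : idomainType) (R' : comNzRingType)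
    (f : {rmorphism R -> R'}) (p y y' : R) (q x x' : R') (a b : letter n) :
  f p = q -> f y = x -> f y' = x' ->
  p != 0 -> p * y' - y != 0 -> 1 - y * (p * y') != 0 ->
  clt (Some b) (Some a) ->
  (x - x')
    *: (sgn_factor q a *: (dblmx L q x' 1 (Some b) *m dblmx L q x 1 (Some a)))
  + ((q - 1) * x)
    *: (sgn_factor q b *: (dblmx L q x' 1 (Some a) *m dblmx L q x 1 (Some b)))
  = (q * x - x')
    *: (sgn_factor q b *: (dblmx L q x 1 (Some a) *m dblmx L q x' 1 (Some b))).
Proof.
move=> <- <- <- p0 n1 n2 ltba.
have fs c : f (sgn_factor p c) = sgn_factor (f p) c.
  by rewrite /sgn_factor; case: ifP; rewrite ?rmorph1.
have e := dblmx_exchange_idomain p0 n1 n2 ltba; rewrite !scalerA in e.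
have {e} := map_linear_mulmx f e.
by rewrite !map_dblmx !(rmorphB, rmorphM, rmorph1) !fs -!scalerA.
Qed.

(* Over a field the polynomials q x' - x and 1 - q x x' may vanish at the given
   point, so they are cancelled at the generic point x + 'X. *)
Lemma dblmx_exchange_field (F : fieldType) (q x x' : F) (a b : letter n) :
  q != 0 -> x' != 0 -> clt (Some b) (Some a) ->
  (x - x')
    *: (sgn_factor q a *: (dblmx L q x' 1 (Some b) *m dblmx L q x 1 (Some a)))
  + ((q - 1) * x)
    *: (sgn_factor q b *: (dblmx L q x' 1 (Some a) *m dblmx L q x 1 (Some b)))
  = (q * x - x')
    *: (sgn_factor q b *: (dblmx L q x 1 (Some a) *m dblmx L q x' 1 (Some b))).
Proof.
move=> q0 x'0; have c0 : q * x' != 0 by rewrite mulf_neq0.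
apply: (@dblmx_exchange_lift _ _ (horner_eval (0 : F)) q%:P (x%:P + 'X) x'%:P).
- by rewrite /= /horner_eval hornerC.
- by rewrite /= /horner_eval !hornerE ?addr0.
- by rewrite /= /horner_eval hornerC.
- by rewrite polyC_eq0.
- rewrite (_ : _ - _ = - ('X - (q * x' - x)%:P)) ?oppr_eq0 ?polyXsubC_eq0 //.
  by rewrite polyCB polyCM; ring.
(* As a polynomial in ['X] this factor has leading coefficient [- (q * x')], nonzero by [c0]. *)
rewrite (_ : 1 - _ = - ((q * x')%:P * ('X - ((q * x')^-1 - x)%:P))).
  by rewrite oppr_eq0 mulf_neq0 ?polyC_eq0 ?polyXsubC_eq0.
have : (q * x')%:P * ((q * x')^-1)%:P = 1 by rewrite -polyCM divff.
by rewrite polyCB polyCM => <-; ring.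
Qed.

End Cancel.

(** * The top strip *)

Section TopStrip.
Variables (n : nat).
Local Notation C := (color n).

Lemma sum_two_colors (V : nmodType) (a : letter n) (f : C -> V) :
  (forall k, k != Some a -> k != None -> f k = 0) ->
  \sum_k f k = f (Some a) + f None.
Proof.
move=> f0; rewrite (bigD1 (Some a)) //= (bigD1 None) //= big1 ?addr0 //.
by move=> k /andP[ka kN]; exact: f0.
Qed.

(** The ratio, in each column, of the Delta weight to the Gamma weight it replaces, up to a sign
    where the path turns down. *)
Definition flip_factor (R : comNzRingType) (q : R) (a : letter n) : R :=
  - (if clt (Some a) None then q else 1).

(* Below a row of +, a path entering a Gamma row from the left turns down at the
   same column as a path entering a Delta row from the right; the Gamma row with
   the path going straight is the empty Delta row, and conversely. *)
Lemma pathsum_flip (R : comNzRingType) (q x y : R) (a : letter n) L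
    (b : 'I_L -> C) :
  let g := pathsum (fun c l r => vtx q x y l None r (b c)) (Some a) in
  let d := pathsum (fun c l r => vtx q (q * y) x None r (b c) l) None in
  [/\ forall k, k != Some a -> k != None -> g k = 0,
      flip_factor q a ^+ L * g (Some a) = d None
    & flip_factor q a ^+ L * g None = - d (Some a)].
Proof.
elim: L b => [|L IH] b /=.
  split=> [k /negPf ka kN||]; rewrite !pathsum0 ?eqxx ?mulr1 ?mulr0 ?oppr0 //.
  by rewrite eq_sym ka.
have /= [g0 ga gN] := IH (fun c => b (lift ord0 c)); move: g0 ga gN.
set g := pathsum _ (Some a); set d := pathsum _ None => g0 ga gN.
have gS k : pathsum (fun c l r => vtx q x y l None r (b c)) (Some a) k
    = g (Some a) * vtx q x y (Some a) None k (b ord0)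
      + g None * vtx q x y None None k (b ord0).
  rewrite pathsumS (@sum_two_colors _ a) // => l la lN.
  by rewrite -/(g l) g0 ?mul0r.
split=> [k /negPf ka /negPf kN||].
- by rewrite gS /vtx /= ka kN /= !mul0r addr0 !mulr0 addr0.
- rewrite gS pathsumS (@sum_two_colors _ a); last first.
    by move=> l /negPf la /negPf lN; rewrite /vtx /= lN andbF mul0r mulr0.
  rewrite -/(d _) -/(d _) -ga /vtx /flip_factor exprS /= !eqxx !andbF !andbT /=.
  case: color_cmpP; intros => //; ring.
- rewrite gS pathsumS (@sum_two_colors _ a); last first.
    move=> l /negPf la /negPf lN.
    by rewrite /vtx /= lN la !andbF !mul0r addr0 mulr0.
  have dE : d (Some a) = - (flip_factor q a ^+ L * g None) by rewrite gN opprK.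
  rewrite -/(d _) -/(d _) -ga dE /vtx /flip_factor exprS /= !eqxx !andbF !andbT /=.
  case: color_cmpP; intros => //; ring.
Qed.

Variable L : nat.
Local Notation S := {ffun 'I_L -> C}.

Definition vacuum : 'I_#|{: S}| := enum_rank ([ffun=> None] : S).

Lemma vacuum_rowmx (R : comNzRingType) (w : C -> C -> C -> C -> R) l r
    (t : 'I_#|{: S}|) :
  rowmx L w l r vacuum t
  = pathsum (fun c i k => w i None k ((enum_val t : S) c)) l r.
Proof.
rewrite mxE; apply: eq_bigr => h _; apply: eq_bigr => c _.
by rewrite enum_rankK ffunE.
Qed.

(** The Gamma row ends with [Some a] or with +. After the flip these become Delta rows ending with +
    and with [Some a], while the cap sends [Some (bar a)] or + into the lower row. *)
Lemma row_dblmx (R : comNzRingType) (q x y : R) (a : letter n) :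
  flip_factor q a ^+ L *: row vacuum (dblmx L q x y (Some a))
  = row vacuum (deltamx L q (q * y) x None None
                *m deltamx L q (q * x) y None (Some (bar a)))
    - row vacuum (deltamx L q (q * y) x None (Some a)
                  *m deltamx L q (q * x) y None None).
Proof.
pose g k := row vacuum (gammamx L q x y (Some a) k).
have g0 k : k != Some a -> k != None -> g k = 0.
  move=> ka kN; apply/rowP => t; rewrite [g _ _ _]mxE vacuum_rowmx [RHS]mxE.
  by have [g0 _ _] := pathsum_flip q x y a (enum_val t : S); exact: g0.
have ga : flip_factor q a ^+ L *: g (Some a)
    = row vacuum (deltamx L q (q * y) x None None).
  apply/rowP => t; rewrite mxE [g _ _ _]mxE [RHS]mxE !vacuum_rowmx.
  by have [_ -> _] := pathsum_flip q x y a (enum_val t : S).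
have gN : flip_factor q a ^+ L *: g None
    = - row vacuum (deltamx L q (q * y) x None (Some a)).
  apply/rowP => t; rewrite [LHS]mxE [g _ _ _]mxE [RHS]mxE [X in - X]mxE !vacuum_rowmx.
  by have [_ _ ->] := pathsum_flip q x y a (enum_val t : S).
have -> : row vacuum (dblmx L q x y (Some a))
    = \sum_k g k *m deltamx L q (q * x) y None (cbar k).
  by rewrite linear_sum; apply: eq_bigr => k _; rewrite /= row_mul.
rewrite (@sum_two_colors _ a) => [|k ka kN]; last by rewrite g0 ?mul0mx.
by rewrite scalerDr !scalemxAl ga gN !row_mul mulNmx.
Qed.

Lemma barK : involutive (@bar n).
Proof. by case=> s i; rewrite /bar /= negbK. Qed.

(** All three strips are combinations of products of the same two Delta rows, which exchanging [x]
    and [y] swaps; the exchange relations of these rows eliminate the products. *)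
Lemma row_dblmx_bar (R : idomainType) (q x y : R) (a : letter n) :
  q != 0 -> clt None (Some a) ->
  (q ^+ L.+1 * (x ^+ 2 - y ^+ 2)) *: row vacuum (dblmx L q x y (Some (bar a)))
  = ((q - 1) * y ^+ 2) *: row vacuum (dblmx L q x y (Some a))
    - (q * x ^+ 2 - y ^+ 2) *: row vacuum (dblmx L q y x (Some a)).
Proof.
move=> q0 a_gt0.
have abar_lt0 : clt (Some (bar a)) None.
  by move: a_gt0; rewrite /clt (color_val_cbar (Some a)) oppr_lt0.
have fa : flip_factor q a = -1 /\ clt (Some a) None = false.
  by rewrite /flip_factor; move: a_gt0; case: color_cmpP.
have fb : flip_factor q (bar a) = - q /\ clt None (Some (bar a)) = false.
  by rewrite /flip_factor; move: abar_lt0; case: color_cmpP.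
have := row_dblmx q x y a; have := row_dblmx q x y (bar a).
have := row_dblmx q y x a; rewrite barK fa.1 fb.1 [(- q) ^+ L]exprNn.
(* The Delta rows are exchanged for both placements of the path: right ends [Some a], + here and +,
   [Some (bar a)] next. *)
have := congr1 (row vacuum) (deltamx_push L q (q * x) y (q * y) x (Some a) None).
have := congr1 (row vacuum)
  (deltamx_push L q (q * x) y (q * y) x None (Some (bar a))).
rewrite /push fa.2 fb.2 /= !(linearD, linearZ) /=.
move: (deltamx L q (q * y) x None) (deltamx L q (q * x) y None) => A B.
move: (row _ (B None *m A (Some (bar a)))) (row _ (A None *m B (Some (bar a))))
  (row _ (A (Some (bar a)) *m B None)) (row _ (B (Some a) *m A None))
  (row _ (A None *m B (Some a))) (row _ (A (Some a) *m B None)).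
move: (row _ (dblmx _ _ _ _ (Some (bar a)))) (row _ (dblmx _ _ x _ (Some a)))
  (row _ (dblmx _ _ y _ (Some a))).
move=> d3 d1 d2 q2 p2 p3 q1 p4 p1 /rowP k2 /rowP k1 /rowP e2 /rowP e3 /rowP e1.
apply/rowP => t; move: {k2 k1 e2 e3 e1} (k2 t) (k1 t) (e2 t) (e3 t) (e1 t).
rewrite !mxE; move: (d3 _ _) (d1 _ _) (d2 _ _) (q2 _ _) (p2 _ _) (p3 _ _)
  (q1 _ _) (p4 _ _) (p1 _ _) => {}d3 {}d1 {}d2 {}q2 {}p2 {}p3 {}q1 {}p4 {}p1.
move=> k2 k1 e2 e3 e1.
(* This multiplier makes the powers [(-1) ^+ L] and [(- q) ^+ L] of the two flip factors appear, so
   that [e1], [e2] and [e3] can be substituted. *)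
have s0 : (-1) ^+ L * q != 0 by rewrite mulf_neq0 // signr_eq0.
apply: (mulfI s0); apply/eqP; rewrite -subr_eq0; apply/eqP.
transitivity (q ^+ 2 * (x ^+ 2 - y ^+ 2) * ((-1) ^+ L * q ^+ L * d3)
  - q * (q - 1) * y ^+ 2 * ((-1) ^+ L * d1)
  + q * (q * x ^+ 2 - y ^+ 2) * ((-1) ^+ L * d2)); first by rewrite exprS; ring.
rewrite e1 e2 e3.
transitivity (q ^+ 2 * (x ^+ 2 - y ^+ 2) * (p4 - p3)
  - q * (q - 1) * y ^+ 2 * (p2 - p1)
  + (q * (q * x * x) - y * (q * y)) * q2 - (q * (q * x * x) - y * (q * y)) * q1).
  by ring.
by rewrite k1 k2; ring.
Qed.

End TopStrip.

(** * The recursions *)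

Section Transfer.
Variables (F : fieldType) (n L : nat).
Local Notation C := (color n).
Local Notation S := {ffun 'I_L -> C}.
Implicit Types (M : 'I_n -> 'M[F]_#|{: S}|) (top : S) (bot : pred S).

Lemma transfer_scale (c : 'I_n -> F) M M' top bot :
  (forall i, M' i = c i *: M i) ->
  transfer M' top bot = (\prod_i c i) * transfer M top bot.
Proof.
move=> e; rewrite /transfer mulr_sumr; apply: eq_bigr => w _.
by rewrite -big_split; apply: eq_bigr => i _; rewrite e mxE.
Qed.

Definition set_level (w : {ffun 'I_n.+1 -> S}) k s : {ffun 'I_n.+1 -> S} :=
  [ffun x => if x == k then s else w x].

(** The [w] are grouped by their values away from [k]; each group is represented by its member with
    the dummy value [s0] at [k]. *)
Lemma sum_set_level (k : 'I_n.+1) (s0 : S) (P : pred {ffun 'I_n.+1 -> S})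
    (f : {ffun 'I_n.+1 -> S} -> F) :
  (forall w s, P (set_level w k s) = P w) ->
  \sum_(w | P w) f w
  = \sum_(w | P w && (w k == s0)) \sum_s f (set_level w k s).
Proof.
move=> Pset.
rewrite (partition_big (fun v => set_level v k s0) (fun w => P w && (w k == s0)));
  last by move=> w; rewrite Pset ffunE !eqxx andbT.
apply: eq_bigr => w /andP[Pw /eqP wk].
have setK v : set_level v k s0 = w -> set_level w k (v k) = v.
  move=> <-; apply/ffunP => x; rewrite !ffunE.
  by case: eqP => [->|].
rewrite (reindex_onto (set_level w k) (fun v => v k)) => [|v /andP[_ /eqP]];
  last exact: setK.
apply: eq_bigl => s; rewrite Pset Pw ffunE !eqxx andbT; apply/eqP/ffunP => x.
by rewrite !ffunE; case: eqP => [->|].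
Qed.

Lemma transfer_pair (i : 'I_n) M top bot : (i.+1 < n)%N ->
  let k := lift ord0 i in
  transfer M top bot
  = \sum_(w : {ffun 'I_n.+1 -> S} |
        [&& w ord_max == top, bot (w ord0) & w k == top])
     (M (ordS i) *m M i) (enum_rank (w (lift ord0 (ordS i))))
                         (enum_rank (w (widen_ord (leqnSn n) i)))
     * \prod_(x | (x != ordS i) && (x != i))
         M x (enum_rank (w (lift ord0 x)))
             (enum_rank (w (widen_ord (leqnSn n) x))).
Proof.
move=> ltin k.
have ij : i != ordS i by rewrite -(inj_eq val_inj) /= modn_small // neq_ltn ltnSn.
have liftk x : (lift ord0 x == k) = (x == i) by rewrite (inj_eq lift_inj).
have widenk x : (widen_ord (leqnSn n) x == k) = (x == ordS i).
  by rewrite -!(inj_eq val_inj) /= modn_small.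
(* Level [k] is neither the top nor the bottom one, so its sum is free and becomes the matrix
   product; [top] is a dummy value. *)
rewrite /transfer (@sum_set_level k top) => [|w s]; last first.
  by rewrite !ffunE -!(inj_eq val_inj) /= [n == _]gtn_eqF.
apply: eq_big => [w|w _]; first by rewrite andbA.
rewrite !mxE mulr_suml (reindex (@enum_rank S)) /=; last first.
  exact/onW_bij/enum_rank_bij.
apply: eq_bigr => s _.
rewrite (bigD1 (ordS i)) // (bigD1 i) //= !ffunE !liftk !widenk !eqxx.
rewrite eq_sym (negPf ij) mulrA.
congr (_ * _); apply: eq_bigr => x /andP[/negPf xj /negPf xi].
by rewrite !ffunE liftk widenk xi xj.
Qed.

Lemma transfer_pair_linear (i : 'I_n) (c1 c2 c3 : F) M1 M2 M3 top bot :
  (i.+1 < n)%N ->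
  (forall x, x != ordS i -> x != i -> ((M1 x = M3 x) * (M2 x = M3 x))%type) ->
  c1 *: (M1 (ordS i) *m M1 i) + c2 *: (M2 (ordS i) *m M2 i)
  = c3 *: (M3 (ordS i) *m M3 i) ->
  c1 * transfer M1 top bot + c2 * transfer M2 top bot
  = c3 * transfer M3 top bot.
Proof.
move=> ltin eM /matrixP e; rewrite !(transfer_pair _ _ _ ltin) !mulr_sumr.
rewrite -big_split; apply: eq_bigr => w _ /=.
have := e (enum_rank (w (lift ord0 (ordS i)))) (enum_rank (w (widen_ord (leqnSn n) i))).
(* The key restricts unfolding to scalings, so the matrix products stay closed. *)
rewrite [LHS]mxE ![in LHS](mxE scalemx_key) [RHS](mxE scalemx_key) !mulrA => <-.
rewrite mulrDl; congr (_ * _ + _ * _);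
  by apply: eq_bigr => x /andP[xj xi]; rewrite (eM x xj xi).
Qed.

Lemma transfer_top_linear (i : 'I_n) (c1 c2 c3 : F) M1 M2 M3 (top : S) bot :
  i.+1 = n -> (forall x, x != i -> ((M1 x = M3 x) * (M2 x = M3 x))%type) ->
  c1 *: row (enum_rank top) (M1 i) + c2 *: row (enum_rank top) (M2 i)
  = c3 *: row (enum_rank top) (M3 i) ->
  c1 * transfer M1 top bot + c2 * transfer M2 top bot
  = c3 * transfer M3 top bot.
Proof.
move=> iE eM /rowP e.
have liE : lift ord0 i = ord_max by apply: val_inj; exact: iE.
rewrite !mulr_sumr -big_split; apply: eq_bigr => w /andP[/eqP wtop _] /=.
have := e (enum_rank (w (widen_ord (leqnSn n) i))); rewrite !mxE => {}e.
rewrite (bigD1 i) //= [X in _ + _ * X](bigD1 i) //= [in RHS](bigD1 i) //=.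
rewrite !liE !wtop !mulrA -e mulrDl; congr (_ * _ + _ * _);
  by apply: eq_bigr => x xi; rewrite (eM x xi).
Qed.

End Transfer.

(** * Ice weights as normalized values of [vtx] *)

Section Weights.
Variables (F : fieldType) (n L : nat) (q u : F).
Local Notation C := (color n).
Hypotheses (q0 : q != 0) (uq : q - u != 0) (u1 : 1 - u != 0).
Implicit Types l t r b : C.

Let z : F := (1 - u) / (q - u).

(** Equal colors have [vtx] weight [q - u]; dividing by it gives the stochastic normalization. *)
Lemma gamma_weight_vtx l t r b :
  gamma_weight q z l t r b = (q - u)^-1 * vtx q u 1 l t r b.
Proof.
rewrite /gamma_weight /vtx /z.
case: (color_cmpP l t) => [|h|h]; intros;
repeat (case: eqP; intros; subst => //=; try lia); rewrite ?ltxx //=.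
all: by field; rewrite ?uq.
Qed.

(** In terms of u, [zprime] is [(1 - q * u) / (1 - u)], and equal colors have [vtx] weight
    [q * (1 - u)]. *)
Lemma delta_weight_vtx l t r b :
  delta_weight q z l t r b = (q * (1 - u))^-1 * vtx q (q * u) 1 t r b l.
Proof.
rewrite /delta_weight /vtx /zprime /z.
case: (color_cmpP l t) => [|h|h]; intros;
repeat (case: color_cmpP; intros; subst => //=; try lia);
repeat (case: eqP; intros; subst => //=; try lia); rewrite ?ltxx //=.
all: by field; rewrite ?uq ?u1 ?q0.
Qed.

Lemma rowmx_scale (c : F) (w w' : C -> C -> C -> C -> F) l r :
  (forall i j k m, w' i j k m = c * w i j k m) ->
  rowmx L w' l r = c ^+ L *: rowmx L w l r.
Proof.
move=> e; apply/matrixP => s t; rewrite !mxE mulr_sumr; apply: eq_bigr => h _.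
rewrite -[in c ^+ _](card_ord L) -prodr_const -big_split.
by apply: eq_bigr => i _; rewrite e.
Qed.

Lemma strip_mx_dblmx l :
  strip_mx L (gamma_weight q z) (delta_weight q z) l
  = ((q - u)^-1 * (q * (1 - u))^-1) ^+ L *: dblmx L q u 1 l.
Proof.
rewrite /strip_mx /dblmx scaler_sumr; apply: eq_bigr => k _.
rewrite (rowmx_scale _ _ (gamma_weight_vtx)).
rewrite (rowmx_scale _ _ (delta_weight_vtx)).
by rewrite -scalemxAl -scalemxAr scalerA exprMn.
Qed.

End Weights.

(** Each of the 2L vertices of a strip is homogeneous of degree one in the parameters. *)
Lemma dblmx_homog (F : fieldType) n L (q c x y : F) (l : color n) :
  dblmx L q (c * x) (c * y) l = (c ^+ L) ^+ 2 *: dblmx L q x y l.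
Proof.
rewrite /dblmx scaler_sumr; apply: eq_bigr => k _.
have vtxZ x' y' (i j m p : color n) : vtx q (c * x') (c * y') i j m p
    = c * vtx q x' y' i j m p :> F.
  by rewrite /vtx; case: ifP => _; case: (clt i j); ring.
rewrite /gammamx /deltamx [q * (c * x)]mulrCA.
rewrite (rowmx_scale _ _ _ (vtxZ x y)).
rewrite (rowmx_scale _ _ _ (fun l t r b => vtxZ (q * x) y t r b l)).
by rewrite -scalemxAl -scalemxAr scalerA -expr2.
Qed.

(** * The recursions for the normalized partition function *)

Section Main.
Variables (F : fieldType) (n L : nat) (lam : n.-tuple nat) (q : F).
Variable tau : {perm letter n}.
Implicit Types (sigma : {perm letter n}) (u : {ffun 'I_n -> F}).

(** Normalizing a strip costs [((q - u) * q * (1 - u)) ^+ L]; dividing by [z ^+ L] replaces [q - u]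
    by [1 - u]. *)
Definition norm_factor u : F := \prod_i (q * (1 - u i) ^+ 2) ^+ L.

Definition strip_transfer sigma u : F :=
  transfer (fun i => dblmx L q (u i) 1 (Some (sigma (pos_letter i))))
    [ffun=> None] (bottom_ok lam tau).

Lemma ZtildeE sigma u : generic q u ->
  Ztilde L lam sigma tau q u
  = q ^+ Ztilde_exponent L sigma / norm_factor u * strip_transfer sigma u.
Proof.
case=> q0 _ uq1.
have uq i : q - u i != 0 by have [uq _] := uq1 i; rewrite subr_eq0 eq_sym.
have u1 i : 1 - u i != 0 by have [_ u1] := uq1 i; rewrite subr_eq0 eq_sym.
rewrite /Ztilde partition_function_transfer.
rewrite (transfer_scale (c := fun i => ((q - u i)^-1 * (q * (1 - u i))^-1) ^+ L)
  (M := fun i => dblmx L q (u i) 1 (Some (sigma (pos_letter i))))); last first.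
  by move=> i; rewrite ffunE strip_mx_dblmx.
rewrite -/(strip_transfer sigma u).
have <- : \prod_i ((q - u i)^-1 * (q * (1 - u i))^-1) ^+ L
    * (\prod_i z_of_u q u i ^+ L)^-1 = (norm_factor u)^-1.
  rewrite -!prodfV -big_split; apply: eq_bigr => i _ /=.
  rewrite ffunE -!exprVn -exprMn; congr (_ ^+ _).
  by field; rewrite uq u1 q0.
by move: (\prod_i _) (\prod_i _)^-1 (strip_transfer _ _) => c d T; ring.
Qed.

Lemma letter_val_neq0 (a : letter n) : letter_val a != 0.
Proof. by case: a => -[] i; rewrite /letter_val. Qed.

Lemma sgn_factorE (a : letter n) :
  sgn_factor q a = q ^+ (0 < letter_val a)%R.
Proof.
rewrite /sgn_factor /clt /=; have := letter_val_neq0 a.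
by case: (ltgtP (letter_val a) 0).
Qed.

Lemma sgn_neq0 (a : letter n) : q != 0 -> sgn_factor q a != 0.
Proof. by move=> q0; rewrite sgn_factorE expf_neq0. Qed.

Lemma srefl_pos (i k : 'I_n) : (i.+1 < n)%N ->
  srefl i (pos_letter k) = pos_letter (tperm i (ordS i) k).
Proof.
move=> lti; rewrite /srefl lti permM /pos_letter.
have -> : tperm (false, i) (false, ordS i) (false, k) = (false, tperm i (ordS i) k).
  case: (tpermP i (ordS i) k) => [->|->|ki kj]; rewrite ?tpermL ?tpermR //.
  by rewrite tpermD // xpair_eqE /= eq_sym; apply/eqP.
exact: tpermD.
Qed.

(** The two exchanged letters have coefficients differing by one; the additive form avoids truncated
    subtraction. *)
Lemma exponent_srefl sigma (i : 'I_n) : (i.+1 < n)%N ->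
  (Ztilde_exponent L (compB sigma (srefl i))
     + (0 < letter_val (sigma (pos_letter i)))%R
   = Ztilde_exponent L sigma
     + (0 < letter_val (sigma (pos_letter (ordS i))))%R)%N.
Proof.
move=> lti; rewrite /Ztilde_exponent.
have sE k : compB sigma (srefl i) (pos_letter k)
    = sigma (pos_letter (tperm i (ordS i) k)) by rewrite permM srefl_pos.
have jE : ordS i = i.+1 :> nat by rewrite /= modn_small.
have ij : i != ordS i by rewrite -(inj_eq val_inj) /= modn_small // neq_ltn ltnSn.
have -> : (\sum_(k < n) (letter_val (compB sigma (srefl i) (pos_letter k)) < 0)%R
  = \sum_(k < n) (letter_val (sigma (pos_letter k)) < 0)%R)%N.
  rewrite [RHS](reindex_inj (@perm_inj _ (tperm i (ordS i)))) /=.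
  by apply: eq_bigr => k _; rewrite sE.
move: (\sum_(k < n) (letter_val _ < 0)%R)%N => N.
have split2 f : (\sum_(k < n) f k
    = f (ordS i) + (f i + \sum_(k < n | (k != ordS i) && (k != i)) f k))%N.
  by rewrite (bigD1 (ordS i)) //= (bigD1 i).
rewrite !split2 !sE tpermL tpermR jE.
have -> : (\sum_(k < n | (k != ordS i) && (k != i)) (n - k.+1) *
    (0 < letter_val (compB sigma (srefl i) (pos_letter k)))%R
  = \sum_(k < n | (k != ordS i) && (k != i)) (n - k.+1) *
    (0 < letter_val (sigma (pos_letter k)))%R)%N.
  by apply: eq_bigr => k /andP[kj ki]; rewrite sE tpermD // eq_sym.
rewrite -(subnSK lti); move: (n - i.+2)%N (nat_of_bool _) (nat_of_bool _) => d a b.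
by rewrite !mulSn; lia.
Qed.

(** The last positive letter has coefficient 0, so only the [L.+1] of the new negative letter
    counts. *)
Lemma exponent_srefl_last sigma (i : 'I_n) :
  sigma \in hyperoct n -> i.+1 = n -> 0 < letter_val (sigma (pos_letter i)) ->
  (Ztilde_exponent L (compB sigma (srefl i)) = Ztilde_exponent L sigma + L.+1)%N.
Proof.
rewrite inE => /forallP hyp iE pos; rewrite /Ztilde_exponent.
have nlt : (i.+1 < n)%N = false by rewrite iE ltnn.
have sE k : k != i -> compB sigma (srefl i) (pos_letter k) = sigma (pos_letter k).
  by move=> ki; rewrite permM /srefl nlt tpermD // xpair_eqE //= eq_sym.
have si : compB sigma (srefl i) (pos_letter i) = bar (sigma (pos_letter i)).
  by rewrite permM /srefl nlt tpermL -(eqP (hyp _)).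
have lvbar (a : letter n) : letter_val (bar a) = - letter_val a.
  exact: (color_val_cbar (Some a)).
rewrite !(bigD1 i (P := xpredT)) //= si lvbar.
rewrite oppr_gt0 oppr_lt0 pos ltNge (ltW pos) /= iE subnn !mul0n !add0n.
rewrite mulnDr muln1 [(L.+1 + _)%N]addnC addnA.
by congr (_ + _ * _ + _)%N; apply: eq_bigr => k ki; rewrite sE.
Qed.

Lemma norm_factor_neq0 u : generic q u -> norm_factor u != 0.
Proof.
case=> q0 _ uq1; apply/prodf_neq0 => i _; rewrite expf_neq0 // mulf_neq0 //.
by rewrite expf_neq0 // subr_eq0 eq_sym; have [] := uq1 i.
Qed.

Lemma Ztilde_srefl sigma (i : 'I_n) u : (i.+1 < n)%N ->
  letter_val (sigma (pos_letter i))
    < letter_val (sigma (pos_letter (ordS i))) ->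
  generic q u -> u (ordS i) != 0 -> ualpha i u != 1 ->
  Ztilde L lam (compB sigma (srefl i)) tau q u
  = DLhat i q (Ztilde L lam sigma tau q) u.
Proof.
move=> lti ltij gu uj0 ua1; have [q0 q1 uq1] := gu.
have gsu : generic q (sact i u).
  by split=> // k; rewrite /sact lti ffunE.
have ij : ordS i != i.
  by rewrite -(inj_eq val_inj) /= modn_small // neq_ltn ltnSn orbT.
set x := u i; set x' := u (ordS i).
have ualE : ualpha i u = x / x' by rewrite /ualpha lti.
have xx' : x - x' != 0.
  by apply: contra_neq ua1 => /eqP; rewrite subr_eq0 ualE => /eqP->; rewrite divff.
set a := sigma (pos_letter (ordS i)); set b := sigma (pos_letter i).
have ltba : clt (Some b) (Some a) by [].
have sE k : compB sigma (srefl i) (pos_letter k)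
    = sigma (pos_letter (tperm i (ordS i) k)) by rewrite permM srefl_pos.
have uE k : sact i u k = u (tperm i (ordS i) k) by rewrite /sact lti ffunE.
have rel : ((x - x') * sgn_factor q a) * strip_transfer (compB sigma (srefl i)) u
    + ((q - 1) * x * sgn_factor q b) * strip_transfer sigma u
    = ((q * x - x') * sgn_factor q b) * strip_transfer sigma (sact i u).
  apply: (transfer_pair_linear (i := i)) => // [k kj ki|].
    by rewrite sE uE tpermD // eq_sym.
  rewrite !sE !uE tpermL tpermR.
  have := @dblmx_exchange_field n L F q x x' a b q0 uj0 ltba.
  by rewrite !scalerA.
have nE : norm_factor (sact i u) = norm_factor u.
  rewrite /norm_factor [RHS](reindex_inj (@perm_inj _ (tperm i (ordS i)))) /=.
  by apply: eq_bigr => k _; rewrite uE.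
have n0 := norm_factor_neq0 gu.
(* The power of q in [Ztilde] absorbs the ratio of the two [sgn_factor]s in [rel]. *)
have hQ : q ^+ Ztilde_exponent L (compB sigma (srefl i)) * sgn_factor q b
    = q ^+ Ztilde_exponent L sigma * sgn_factor q a.
  by rewrite !sgn_factorE -!exprD exponent_srefl.
rewrite /DLhat /DL ualE !ZtildeE // nE; move: rel n0 hQ (sgn_neq0 a q0).
move: (strip_transfer _ (sact _ _)) (strip_transfer sigma u) (strip_transfer _ _).
move: (norm_factor u) (sgn_factor q a) (sgn_factor q b).
move: (q ^+ Ztilde_exponent _ sigma) (q ^+ _).
move=> QB QA d sa sb TC TB TA rel d0 hQ sa0.
apply: (mulfI (mulf_neq0 xx' sa0)).
transitivity (QA * sb / d * ((q * x - x') * TC - (q - 1) * x * TB)).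
  transitivity (QA / d * ((x - x') * sa * TA + (q - 1) * x * sb * TB
    - (q - 1) * x * sb * TB)); first by ring.
  by rewrite rel; ring.
by rewrite hQ; field; rewrite d0 uj0 mulN1r xx'.
Qed.

Lemma Ztilde_srefl_last sigma (i : 'I_n) u :
  sigma \in hyperoct n -> i.+1 = n -> 0 < letter_val (sigma (pos_letter i)) ->
  generic q u -> generic q (sact i u) -> u i != 0 -> ualpha i u != 1 ->
  Ztilde L lam (compB sigma (srefl i)) tau q u
  = - DL i q (Ztilde L lam sigma tau q) u.
Proof.
move=> hyp iE a_gt0 gu gsu ui0 ua1; have [q0 _ _] := gu.
have nlt : (i.+1 < n)%N = false by rewrite iE ltnn.
set x := u i; set a := sigma (pos_letter i).
have ualE : ualpha i u = x ^+ 2 by rewrite /ualpha nlt.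
have xx1 : x ^+ 2 - 1 != 0 by rewrite subr_eq0 -ualE.
have sE k : k != i -> compB sigma (srefl i) (pos_letter k) = sigma (pos_letter k).
  by move=> ki; rewrite permM /srefl nlt tpermD // xpair_eqE //= eq_sym.
have si : compB sigma (srefl i) (pos_letter i) = bar a.
  move: hyp; rewrite inE => /forallP hyp.
  by rewrite permM /srefl nlt tpermL -(eqP (hyp _)).
have uE k : k != i -> sact i u k = u k.
  by move=> /negPf ki; rewrite /sact nlt ffunE ki.
have ui : sact i u i = x^-1 by rewrite /sact nlt ffunE eqxx.
have rel : (q ^+ L.+1 * (x ^+ 2 - 1)) * strip_transfer (compB sigma (srefl i)) u
    + (1 - q) * strip_transfer sigma u
    = (- ((q * x ^+ 2 - 1) * (x ^+ L) ^+ 2)) * strip_transfer sigma (sact i u).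
  apply: (transfer_top_linear (i := i)) => // [k ki|].
    by rewrite sE // uE.
  rewrite si ui -/x -/a.
  have := row_dblmx_bar L x 1 q0 (a_gt0 : clt None (Some a)).
  rewrite !expr1n !mulr1 => ->.
  (* Exchanging the parameters [x] and 1 is the inversion of u_n, up to homogeneity. *)
  have -> : dblmx L q 1 x (Some a) = (x ^+ L) ^+ 2 *: dblmx L q x^-1 1 (Some a).
    by rewrite -dblmx_homog mulfV // mulr1.
  by apply/rowP => t; rewrite !mxE; ring.
(* Since [(1 - x^-1) ^+ 2 = (1 - x) ^+ 2 / x ^+ 2], the normalization absorbs the power of [x] from
   homogeneity. *)
have nE : norm_factor u = norm_factor (sact i u) * (x ^+ L) ^+ 2.
  rewrite /norm_factor (bigD1 i) //= [in RHS](bigD1 i) //= ui mulrAC.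
  congr (_ * _); last by apply: eq_bigr => k ki; rewrite uE.
  rewrite exprAC -exprMn; congr (_ ^+ _); rewrite -/x; field; exact: ui0.
have n0 := norm_factor_neq0 gu; have n0' := norm_factor_neq0 gsu.
rewrite /DL ualE !ZtildeE // (exponent_srefl_last hyp iE a_gt0) exprD.
rewrite nE in n0 *; move: rel n0 n0'.
move: (strip_transfer _ (sact _ _)) (strip_transfer sigma u) (strip_transfer _ _).
move: (norm_factor _) (q ^+ L.+1) (q ^+ Ztilde_exponent _ _) (x ^+ L).
move=> d QL Q xL TC TB TA rel dx0 d0.
have xL0 : xL != 0 by move: dx0; rewrite mulf_eq0 expf_eq0 => /norP[].
apply: (mulfI xx1).
transitivity (Q / (d * xL ^+ 2) * (QL * (x ^+ 2 - 1) * TA + (1 - q) * TB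
  - (1 - q) * TB)); first by ring.
by rewrite rel; field; rewrite xL0 d0 xx1.
Qed.

End Main.

Theorem theorem3p6 (F : fieldType) (n L : nat) (lam : n.-tuple nat)
    (sigma tau : {perm letter n}) (q : F) :
  sigma \in hyperoct n -> tau \in hyperoct n ->
  sorted geq lam -> (nth 0%N lam 0 + n <= L)%N ->
  (forall i : 'I_n, (i.+1 < n)%N ->
     letter_val (sigma (pos_letter i))
       < letter_val (sigma (pos_letter (ordS i))) ->
     forall u : {ffun 'I_n -> F},
       generic q u ->
       u (ordS i) != 0 -> ualpha i u != 1 ->
       Ztilde L lam (compB sigma (srefl i)) tau q u
       = DLhat i q (Ztilde L lam sigma tau q) u)
  /\
  (forall i : 'I_n, i.+1 = n ->
     0 < letter_val (sigma (pos_letter i)) ->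
     forall u : {ffun 'I_n -> F},
       generic q u -> generic q (sact i u) ->
       u i != 0 -> ualpha i u != 1 ->
       Ztilde L lam (compB sigma (srefl i)) tau q u
       = - DL i q (Ztilde L lam sigma tau q) u).
Proof.
move=> hyp _ _ _; split=> i.
  by move=> lti ltij u gu uj0 ua1; exact: Ztilde_srefl.
by move=> iE pos u gu gsu ui0 ua1; exact: Ztilde_srefl_last.
Qed.
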